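(* Let $(R,\mathfrak m)$ be a Noetherian local ring and $M$ a finitely generated $R$-module of dimension $d$. Suppose $M$ has a Macaulayfication $M'$, i.e. there is an exact sequence $0\to M\to M'\to N\to 0$ with $M'$ a finitely generated Cohen–Macaulay $R$-module and $\dim N \le d-2$; here $N = M'/M$. Let $\underline{x}=x_1,\dots,x_d$ be an arbitrary system of parameters of $M$. Then $$J_{\underline{x},M}(\underline{n}) = \ell\big(N/(x_1^{n_1},\dots,x_d^{n_d})N\big)$$ for all $d$-tuples $\underline{n}=(n_1,\dots,n_d)$ of positive integers.
   Context: $J_{\underline{x},M}(\underline{n}) = e(\underline{x}^{\underline{n}};M) - \ell(M/(\underline{x}^{\underline{n}})^{\lim}_M)$, where $\underline{x}^{\underline{n}} = x_1^{n_1},\dots,x_d^{n_d}$, $e$ is the Serre multiplicity, $\ell$ is length, and for a system of parameters $\underline{y}$ of $M$, $(\underline{y})^{\lim}_M = \bigcup_{n>0}\big((y_1^{n+1},\dots,y_d^{n+1})M :_M (y_1\cdots y_d)^n\big)$ is the limit closure. *)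

(* Defs.v *)
From HB Require Import structures.
From mathcomp Require Import all_boot all_order all_algebra.
From Stdlib Require Import ClassicalEpsilon.
Set Implicit Arguments. Unset Strict Implicit. Unset Printing Implicit Defensive.
Import GRing.Theory.
Local Open Scope ring_scope.

Section RingDefs.
Variable R : comNzRingType.

Definition is_ideal (I : R -> Prop) :=
  I 0 /\ (forall a b, I a -> I b -> I (a + b)) /\ (forall r a, I a -> I (r * a)).

Definition is_prime_ideal (P : R -> Prop) :=
  is_ideal P /\ ~ P 1 /\ (forall a b, P (a * b) -> P a \/ P b).

Definition is_maximal_ideal (I : R -> Prop) :=
  is_ideal I /\ ~ I 1 /\
  (forall J, is_ideal J -> (forall a, I a -> J a) -> ~ J 1 -> forall a, J a -> I a).

Definition noetherian_ring :=
  forall I : nat -> R -> Prop, (forall k, is_ideal (I k)) ->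
  (forall k a, I k a -> I k.+1 a) ->
  exists k0, forall k, (k0 <= k)%N -> forall a, I k a -> I k0 a.

Definition local_ring_with (m : R -> Prop) :=
  is_maximal_ideal m /\ (forall I, is_maximal_ideal I -> forall a, I a <-> m a).

Fixpoint powgens (s : seq R) (k : nat) : seq R :=
  if k is k'.+1 then [seq a * b | a <- s, b <- powgens s k'] else [:: 1].

End RingDefs.

Section ModDefs.
Variable R : comNzRingType.
Variable V : lmodType R.

Definition is_submod (S : V -> Prop) :=
  S 0 /\ (forall u v, S u -> S v -> S (u + v)) /\ (forall r v, S v -> S (r *: v)).

Definition IM (g : seq R) : V -> Prop := fun v =>
  exists ms : seq V, size ms = size g /\ v = \sum_(i < size g) g`_i *: ms`_i.

Definition fin_gen := exists s : seq V, forall v : V,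
  exists rs : seq R, size rs = size s /\ v = \sum_(i < size s) rs`_i *: s`_i.

Definition ann : R -> Prop := fun r => forall v : V, r *: v = 0.

Definition prime_chain (c : nat -> R -> Prop) (k : nat) :=
  (forall i, (i <= k)%N -> is_prime_ideal (c i)) /\
  (forall i, (i < k)%N -> (forall a, c i a -> c i.+1 a) /\ exists a, c i.+1 a /\ ~ c i a) /\
  (forall a, ann a -> c 0 a).

(* dim V <= k  (Krull dimension of R / Ann V; the zero module has dim -oo) *)
Definition dim_le (k : int) := forall c n, prime_chain c n -> (n%:Z <= k).
Definition dim_eq (d : nat) := dim_le d%:Z /\ exists c, prime_chain c d.

Definition sub_chain (B A : V -> Prop) (c : nat -> V -> Prop) (k : nat) :=
  (forall i, (i <= k)%N -> is_submod (c i)) /\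
  (forall v, c 0%N v <-> B v) /\ (forall v, c k v <-> A v) /\
  (forall i, (i < k)%N -> (forall v, c i v -> c i.+1 v) /\ exists v, c i.+1 v /\ ~ c i v).

Definition is_length (B A : V -> Prop) (n : nat) :=
  (exists c, sub_chain B A c n) /\ (forall c k, sub_chain B A c k -> (k <= n)%N).

Definition qlen (B A : V -> Prop) : nat := epsilon (inhabits 0%N) (is_length B A).

Definition ell (B : V -> Prop) : nat := qlen B (fun _ => True).

Definition is_mult (x : seq R) (e : nat) :=
  exists P : {poly rat}, (size P <= (size x).+1)%N /\
    P`_(size x) = e%:R / ((size x)`!)%:R /\
    exists n0, forall n, (n0 <= n)%N -> ((ell (IM (powgens x n)))%:R : rat) = P.[n%:R].

Definition emult (x : seq R) : nat := epsilon (inhabits 0%N) (is_mult x).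

Definition colon (S : V -> Prop) (r : R) : V -> Prop := fun v => S (r *: v).

Definition limcl (y : seq R) : V -> Prop := fun v =>
  exists t, (0 < t)%N /\
    colon (IM [seq a ^+ t.+1 | a <- y]) (\prod_(a <- y) a ^+ t) v.

Definition xpow (x : seq R) (n : seq nat) : seq R :=
  [seq x`_i ^+ (nth 0%N n i) | i <- iota 0 (size x)].
Definition Jfun (x : seq R) (n : seq nat) : int :=
  (emult (xpow x n))%:Z - (ell (limcl (xpow x n)))%:Z.

Definition regular_seq (m : R -> Prop) (y : seq R) :=
  (forall i, (i < size y)%N -> m y`_i) /\
  (forall i, (i < size y)%N -> forall v, IM (take i y) (y`_i *: v) -> IM (take i y) v) /\
  (exists v, ~ IM y v).

(* Cohen-Macaulay: depth V = dim V (the zero module counts as CM) *)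
Definition cohen_macaulay (m : R -> Prop) :=
  forall d, dim_eq d -> exists y, size y = d /\ regular_seq m y.

Definition sop (m : R -> Prop) (x : seq R) :=
  (forall i, (i < size x)%N -> m x`_i) /\ dim_eq (size x) /\
  exists n, is_length (IM x) (fun _ => True) n.

End ModDefs.

Arguments IM {R} V g _.
Arguments ell {R V} B.

(* Main.v *)
Require Import Defs.
From HB Require Import structures.
From mathcomp Require Import all_boot all_order all_algebra.
From mathcomp Require Import zify ring.
From Stdlib Require Import Classical ClassicalEpsilon FunctionalExtensionality PropExtensionality.
Set Implicit Arguments. Unset Strict Implicit. Unset Printing Implicit Defensive.
Import Order.TTheory GRing.Theory Num.Theory.
Local Open Scope ring_scope.

(** Write y = x^n and let S be the image of M in M'. A Cohen-Macaulay module has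
    no nonzero submodule of smaller dimension, so Ann M = Ann M' and y is a system
    of parameters of M', hence (Koszul homology) a regular sequence on M' in every
    order and after replacing its terms by powers. Consequently
    y^a v in (y_i^(a_i+1)) M' forces v in yM', which gives both e(y; M') = l(M'/yM')
    and limcl_M(y) inside M :&: yM'. As dim N < d, e(y; M) = e(y; M').

    For M :&: yM' inside limcl_M(y), choose a system of parameters z of M' in (y)
    whose first two terms annihilate N, so that any product of all but one of the
    z_i maps M' into M. Write z = A y and y^s = C z^2; the determinants of
    C diag(z) A and of diag(y^(s-1)) agree modulo (y^(2s)) after multiplication by
    the product of the y_i^s, which carries the membership from z back to y.
    Then e(y; M) - l(M/(M :&: yM')) = l(M'/yM') - l((M + yM')/yM') = l(N/yN).

    Modules V/B are handled as pairs of a module V and a submodule B, and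
    submodules are predicates. *)

(** * Submodules and length *)

(** In terms of local cohomology, limcl_M(y)/yM is the kernel of M/yM -> H^d(M), the map M'/yM' ->
    H^d(M') is injective, and dim N <= d-2 kills H^(d-1)(N) and H^d(N). Hence H^d(M) and H^d(M')
    agree, and limcl_M(y) is the part of M inside yM'. The determinants carry out this argument on
    elements. The obstacle is that the terms of y need not annihilate N, while the limit closure is
    defined through y; hence the detour through z. Two annihilating terms are asked of z because
    each product omits one factor, and dim N <= d-2 leaves room for both. For d < 2 it gives N = 0
    instead.

    The multiplicity is the leading coefficient of a Hilbert function. Put I = (y). Ordering the
    monomials in y splits l(V/I^nV) into lengths of V modulo submodules that grow with the exponent
    vector, and summing over these vectors makes the function eventually polynomial, without graded
    rings. On a Cohen-Macaulay module all these submodules equal yV, which gives e(y; V) =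
    l(V/yV). *)

Definition sub T (A B : T -> Prop) := forall v, A v -> B v.

Definition full T : T -> Prop := fun _ => True.

Lemma sub_refl T (A : T -> Prop) : sub A A. Proof. by []. Qed.
#[global] Hint Resolve sub_refl : core.

Lemma pred_ext T (A B : T -> Prop) : sub A B -> sub B A -> A = B.
Proof.
move=> AB BA; apply: functional_extensionality => v.
by apply: propositional_extensionality; split; [apply: AB | apply: BA].
Qed.

Lemma not_sub T (A B : T -> Prop) : ~ sub A B -> exists v, A v /\ ~ B v.
Proof.
move=> /not_all_ex_not [v h]; exists v.
by have [] := imply_to_and _ _ h.
Qed.

Lemma nat_max_exists (P : nat -> Prop) N :
  (exists n, P n) -> (forall n, P n -> (n <= N)%N) ->
  exists n, P n /\ forall k, P k -> (k <= n)%N.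
Proof.
elim: N => [|N IH] [n Pn] hN.
  by exists n; split=> // k /hN; have := hN _ Pn; lia.
have [PN|nPN] := classic (P N.+1); first by exists N.+1.
apply: IH; first by exists n.
move=> k Pk; have := hN k Pk; rewrite leq_eqVlt => /orP[/eqP e|//].
by case: nPN; rewrite -e.
Qed.

Section Submodules.
Variables (R : comNzRingType) (V : lmodType R).
Implicit Types (A B C S : V -> Prop).

Definition null : V -> Prop := fun v => v = 0.
Definition sadd A B : V -> Prop := fun v => exists a b, A a /\ B b /\ v = a + b.
Definition scap A B : V -> Prop := fun v => A v /\ B v.
Definition simg (c : R) : V -> Prop := fun v => exists u, v = c *: u.

Lemma submod0 S : is_submod S -> S 0. Proof. by case. Qed.
Lemma submodD S u v : is_submod S -> S u -> S v -> S (u + v).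
Proof. by move=> [_ [h _]]; apply: h. Qed.
Lemma submodZ S r v : is_submod S -> S v -> S (r *: v).
Proof. by move=> [_ [_ h]]; apply: h. Qed.
Lemma submodN S v : is_submod S -> S v -> S (- v).
Proof. by move=> h Sv; rewrite -scaleN1r; apply: submodZ. Qed.
Lemma submodB S u v : is_submod S -> S u -> S v -> S (u - v).
Proof. by move=> h Su Sv; apply: submodD => //; apply: submodN. Qed.
Lemma submod_sum S I (r : seq I) (P : pred I) (F : I -> V) :
  is_submod S -> (forall i, P i -> S (F i)) -> S (\sum_(i <- r | P i) F i).
Proof.
move=> h hF; apply: big_ind => //; first exact: submod0.
by move=> u v; apply: submodD.
Qed.

Lemma null_submod : is_submod null.
Proof.
split=> //; split=> [u v -> ->|r v ->]; [exact: addr0|exact: scaler0].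
Qed.
Lemma sadd_submod A B : is_submod A -> is_submod B -> is_submod (sadd A B).
Proof.
move=> hA hB; split.
  by exists 0, 0; rewrite addr0; do !split; apply: submod0.
split=> [u v [a [b [Aa [Bb ->]]]] [a' [b' [Aa' [Bb' ->]]]]|r v [a [b [Aa [Bb ->]]]]].
  exists (a + a'), (b + b'); rewrite addrACA.
  by do !split; apply: submodD.
by exists (r *: a), (r *: b); rewrite scalerDr; do !split; apply: submodZ.
Qed.
Lemma scap_submod A B : is_submod A -> is_submod B -> is_submod (scap A B).
Proof.
move=> hA hB; split; first by split; apply: submod0.
by split=> [u v [Au Bu] [Av Bv]|r v [Av Bv]]; split;
  [apply: submodD|apply: submodD|apply: submodZ|apply: submodZ].
Qed.
Lemma simg_submod c : is_submod (simg c).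
Proof.
split; first by exists 0; rewrite scaler0.
split=> [u v [u' ->] [v' ->]|r v [v' ->]]; first by exists (u' + v'); rewrite scalerDr.
by exists (r *: v'); rewrite !scalerA mulrC.
Qed.
Lemma colon_submod S r : is_submod S -> is_submod (colon S r).
Proof.
move=> hS; rewrite /colon; split; first by rewrite scaler0; apply: submod0.
split=> [u v Su Sv|s v Sv]; first by rewrite scalerDr; apply: submodD.
by rewrite scalerA mulrC -scalerA; apply: submodZ.
Qed.

Lemma sub_saddl A B : is_submod B -> sub A (sadd A B).
Proof. by move=> hB v Av; exists v, 0; rewrite addr0; do !split=> //; apply: submod0. Qed.
Lemma sub_saddr A B : is_submod A -> sub B (sadd A B).
Proof. by move=> hA v Bv; exists 0, v; rewrite add0r; do !split=> //; apply: submod0. Qed.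
Lemma sadd_sub A B S : is_submod S -> sub A S -> sub B S -> sub (sadd A B) S.
Proof. by move=> hS AS BS v [a [b [/AS Sa [/BS Sb ->]]]]; apply: submodD. Qed.

Lemma IM_submod (g : seq R) : is_submod (IM V g).
Proof.
split.
  exists (nseq (size g) 0); rewrite size_nseq; split=> //.
  by rewrite big1 // => i _; rewrite nth_nseq ltn_ord scaler0.
split=> [u v [ms [sm ->]] [ns [sn ->]]|r v [ms [sm ->]]].
  exists (mkseq (fun i => ms`_i + ns`_i) (size g)); rewrite size_mkseq; split=> //.
  rewrite -big_split; apply: eq_bigr => i _.
  by rewrite nth_mkseq ?ltn_ord // scalerDr.
exists (mkseq (fun i => r *: ms`_i) (size g)); rewrite size_mkseq; split=> //.
rewrite scaler_sumr; apply: eq_bigr => i _.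
by rewrite nth_mkseq ?ltn_ord // !scalerA mulrC.
Qed.

Lemma IM_gen (g : seq R) a u : a \in g -> IM V g (a *: u).
Proof.
move=> ag; have lt : (index a g < size g)%N by rewrite index_mem.
exists (mkseq (fun i => if i == index a g then u else 0) (size g)).
rewrite size_mkseq; split=> //.
rewrite (bigD1 (Ordinal lt)) //= nth_mkseq // eqxx nth_index //.
rewrite big1 ?addr0 // => i ne; rewrite nth_mkseq ?ltn_ord //.
by rewrite -(inj_eq val_inj) /= in ne; rewrite (negPf ne) scaler0.
Qed.

Lemma IM_min (g : seq R) S :
  is_submod S -> (forall a u, a \in g -> S (a *: u)) -> sub (IM V g) S.
Proof.
move=> hS h v [ms [_ ->]]; apply: submod_sum => // i _; apply: h.
exact: mem_nth.
Qed.

Lemma IM_subset (g g' : seq R) : {subset g <= g'} -> sub (IM V g) (IM V g').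
Proof.
by move=> gg'; apply: IM_min; [apply: IM_submod|move=> a u /gg'; apply: IM_gen].
Qed.

Lemma IM_cat (g g' : seq R) : IM V (g ++ g') = sadd (IM V g) (IM V g').
Proof.
have h1 := IM_submod g; have h2 := IM_submod g'.
apply: pred_ext; last first.
  apply: sadd_sub; first exact: IM_submod.
    by apply: IM_subset => a ag; rewrite mem_cat ag.
  by apply: IM_subset => a ag; rewrite mem_cat ag orbT.
apply: IM_min; first exact: sadd_submod.
move=> a u; rewrite mem_cat => /orP[ag|ag].
  by apply: sub_saddl => //; apply: IM_gen.
by apply: sub_saddr => //; apply: IM_gen.
Qed.

Lemma IM1 a : IM V [:: a] = simg a.
Proof.
apply: pred_ext; last by move=> v [u ->]; apply: IM_gen; rewrite inE.
apply: IM_min; first exact: simg_submod.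
by move=> b u; rewrite inE => /eqP ->; exists u.
Qed.

Lemma IM_nil : IM V [::] = null.
Proof.
apply: pred_ext; last by move=> v ->; apply: submod0 (IM_submod _).
by apply: IM_min => //; apply: null_submod.
Qed.

(** The chains of [sub_chain] in inductive form, growing at the top, so that refinement and
    transport go by induction on the chain. *)
Inductive pchain B : (V -> Prop) -> nat -> Prop :=
| pchain0 : is_submod B -> pchain B B 0
| pchainS A A' k : pchain B A k -> is_submod A' -> sub A A' -> ~ sub A' A ->
    pchain B A' k.+1.

Lemma pchain_submodl B A k : pchain B A k -> is_submod B.
Proof. by elim. Qed.
Lemma pchain_submodr B A k : pchain B A k -> is_submod A.
Proof. by case. Qed.
Lemma pchain_sub B A k : pchain B A k -> sub B A.
Proof. by elim=> [_ v //|A1 A2 n _ IH _ s _ v /IH /s]. Qed.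

Lemma pchain_cat B C A p q : pchain B C p -> pchain C A q -> pchain B A (p + q).
Proof.
move=> h; elim=> [_|A1 A2 n h1 IH ? ? ?]; first by rewrite addn0.
by rewrite addnS; apply: pchainS IH _ _ _.
Qed.

Lemma pchainP B A k : (exists c, sub_chain B A c k) <-> pchain B A k.
Proof.
split.
  elim: k A => [|k IH] A [c [sm [e0 [ek st]]]].
    have -> : A = B by apply: pred_ext => v; [move/ek/e0|move/e0/ek].
    have -> : B = c 0%N by apply: pred_ext => v /e0.
    by apply: pchain0; apply: sm.
  have -> : A = c k.+1 by apply: pred_ext => v /ek.
  have [asc [v [v1 v2]]] := st k (ltnSn k).
  apply: (@pchainS _ (c k)) => //; last 1 first.
  - by move=> /(_ _ v1).
  - apply: IH; exists c; split; first by move=> i ik; apply: sm; lia.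
    by split=> //; split=> // i ik; apply: st; lia.
  - exact: sm.
elim=> [hB|A1 A2 n h [c [sm [e0 [ek st]]]] hA s ns].
  by exists (fun _ => B); do !split=> //.
exists (fun i => if (i <= n)%N then c i else A2); split.
  by move=> i; case: ifP => [/sm//|_ _].
split; first by move=> v; rewrite leq0n; apply: e0.
split; first by rewrite ltnn.
move=> i; rewrite ltnS => le; have [lt|ge] := ltnP i n.
  by rewrite (ltnW lt); apply: st.
have -> : i = n by lia.
rewrite leqnn; split; first by move=> v /ek /s.
by have [v [? nv]] := not_sub ns; exists v; split=> // /ek; exact: nv.
Qed.

Lemma is_lengthP B A n :
  is_length B A n <-> pchain B A n /\ (forall k, pchain B A k -> (k <= n)%N).
Proof.
split=> [[/pchainP h hm]|[/pchainP h hm]]; split=> //.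
  by move=> k /pchainP [c]; apply: hm.
by move=> c k hc; apply: hm; apply/pchainP; exists c.
Qed.

Definition finlen B A := exists n, is_length B A n.

Lemma pchain_exists B A : is_submod B -> is_submod A -> sub B A -> exists k, pchain B A k.
Proof.
move=> hB hA BA; have [AB|nAB] := classic (sub A B).
  by exists 0%N; rewrite (pred_ext AB BA); apply: pchain0.
by exists 1%N; apply: pchainS BA nAB => //; apply: pchain0.
Qed.

Lemma finlen_bound B A N : is_submod B -> is_submod A -> sub B A ->
  (forall k, pchain B A k -> (k <= N)%N) -> finlen B A.
Proof.
move=> hB hA BA hN.
have [|n [hn hm]] := nat_max_exists _ hN; last by exists n; apply/is_lengthP.
exact: pchain_exists.
Qed.

Lemma qlenP B A : finlen B A -> is_length B A (qlen B A).
Proof. by move=> h; apply: epsilon_spec. Qed.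

Lemma is_length_qlen B A n : is_length B A n -> qlen B A = n.
Proof.
move=> h; have /is_lengthP[h1 m1] := qlenP (ex_intro _ n h).
move/is_lengthP: h => [h2 m2].
by have := m1 _ h2; have := m2 _ h1; lia.
Qed.

(* Intersecting with C and adding C to a strict chain keeps each step strict on at least one side (modular law). *)
Lemma pchain_split B A C k : is_submod C -> pchain B A k ->
  exists p q, pchain (scap B C) (scap A C) p /\ pchain (sadd B C) (sadd A C) q /\ (k <= p + q)%N.
Proof.
move=> hC; elim=> [hB|A1 A2 n h [p [q [hp [hq npq]]]] hA2 s ns].
  by exists 0%N, 0%N; split; [apply: pchain0; apply: scap_submod|split=> //; apply: pchain0; apply: sadd_submod].
have hA1 := pchain_submodr h.
have s1 : sub (scap A1 C) (scap A2 C) by move=> v [/s ? ?].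
have s2 : sub (sadd A1 C) (sadd A2 C).
  by move=> v [a [c [/s ? [? ->]]]]; exists a, c.
have [i1|n1] := classic (sub (scap A2 C) (scap A1 C)).
  have n2 : ~ sub (sadd A2 C) (sadd A1 C).
    move=> i2; apply: ns => v A2v.
    have [a [c [A1a [Cc e]]]] := i2 _ (sub_saddl hC A2v).
    rewrite e; apply: submodD => //.
    suff /i1 [] : scap A2 C c by [].
    split=> //.
    have -> : c = v - a by rewrite e addrC addKr.
    by apply: submodB => //; apply: s.
  exists p, q.+1; rewrite (pred_ext i1 s1); split=> //; split; last by lia.
  by apply: pchainS hq _ s2 n2; apply: sadd_submod.
exists p.+1; have hp' : pchain (scap B C) (scap A2 C) p.+1.
  by apply: pchainS hp _ s1 n1; apply: scap_submod.
have [i2|n2] := classic (sub (sadd A2 C) (sadd A1 C)).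
  by exists q; rewrite (pred_ext i2 s2); do !split=> //; lia.
exists q.+1; do !split=> //; last by lia.
by apply: pchainS hq _ s2 n2; apply: sadd_submod.
Qed.

(** Split along [C], a chain from [B] to [A] yields one inside C/B and one inside A/C, so its length
    is at most [p + q]; concatenation attains this. *)
Lemma is_length_add B C A p q : is_length B C p -> is_length C A q ->
  is_length B A (p + q).
Proof.
move=> /is_lengthP[h1 m1] /is_lengthP[h2 m2]; apply/is_lengthP.
split; first exact: pchain_cat h1 h2.
have hC := pchain_submodr h1; have BC := pchain_sub h1; have CA := pchain_sub h2.
have hA := pchain_submodr h2; have hB := pchain_submodl h1.
move=> k /(pchain_split hC) [p' [q' [hp [hq le]]]].
have eB : scap B C = B by apply: pred_ext => [v []|v Bv] //; split=> //; apply: BC.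
have eC : scap A C = C by apply: pred_ext => [v []|v Bv] //; split=> //; apply: CA.
have eBC : sadd B C = C by apply: pred_ext; [apply: sadd_sub|apply: sub_saddr].
have eA : sadd A C = A by apply: pred_ext; [apply: sadd_sub|apply: sub_saddl].
rewrite eB eC in hp; rewrite eBC eA in hq.
by have := m1 _ hp; have := m2 _ hq; lia.
Qed.

Lemma finlen_add B C A : finlen B C -> finlen C A -> finlen B A.
Proof. by move=> [p hp] [q hq]; exists (p + q)%N; apply: is_length_add hp hq. Qed.

Lemma finlen_sub B C A : is_submod C -> sub B C -> sub C A -> finlen B A ->
  finlen B C /\ finlen C A.
Proof.
move=> hC BC CA [n /is_lengthP[h hm]].
have hB := pchain_submodl h; have hA := pchain_submodr h.
split; apply: (@finlen_bound _ _ n) => // k hk.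
  have [j hj] := pchain_exists hC hA CA.
  by have := hm _ (pchain_cat hk hj); lia.
have [j hj] := pchain_exists hB hC BC.
by have := hm _ (pchain_cat hj hk); lia.
Qed.

Lemma qlen_add B C A : is_submod C -> sub B C -> sub C A -> finlen B A ->
  qlen B A = (qlen B C + qlen C A)%N.
Proof.
move=> hC BC CA h; have [h1 h2] := finlen_sub hC BC CA h.
by apply: is_length_qlen; apply: is_length_add; apply: qlenP.
Qed.

Lemma finlenxx A : is_submod A -> finlen A A.
Proof.
move=> hA; apply: (@finlen_bound _ _ 0) => // k.
have gen X : pchain A X k -> sub X A -> (k <= 0)%N.
  by case=> // A1 A2 n h _ _ ns /= s; case: ns => v /s; apply: (pchain_sub h).
by move/gen; apply.
Qed.

Lemma qlenxx A : is_submod A -> qlen A A = 0%N.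
Proof. by move=> hA; have := qlen_add hA (fun v h => h) (fun v h => h) (finlenxx hA); lia. Qed.

End Submodules.

Arguments simg {R} V c _.

(** * Transport of lengths along linear maps *)

Definition is_linear (R : comNzRingType) (V W : lmodType R) (h : V -> W) :=
  (forall u v, h (u + v) = h u + h v) /\ (forall r v, h (r *: v) = r *: h v).

Section Transfer.
Variables (R : comNzRingType) (V W : lmodType R) (h : V -> W).
Hypothesis hl : is_linear h.

Lemma lin0 : h 0 = 0. Proof. by rewrite -(scale0r 0) (proj2 hl) scale0r. Qed.
Lemma linB u v : h (u - v) = h u - h v.
Proof. by rewrite (proj1 hl) -scaleN1r (proj2 hl) scaleN1r. Qed.

Lemma preim_submod (S : W -> Prop) : is_submod S -> is_submod (fun v => S (h v)).
Proof.
move=> hS; split; first by rewrite lin0; apply: submod0.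
split=> [u v Su Sv|r v Sv]; first by rewrite (proj1 hl); apply: submodD.
by rewrite (proj2 hl); apply: submodZ.
Qed.

Definition imgp (S : V -> Prop) : W -> Prop := fun w => exists v, S v /\ w = h v.

Lemma imgp_submod S : is_submod S -> is_submod (imgp S).
Proof.
move=> hS; split; first by exists 0; rewrite lin0; split=> //; apply: submod0.
split=> [u v [u' [Su ->]] [v' [Sv ->]]|r v [v' [Sv ->]]].
  by exists (u' + v'); rewrite (proj1 hl); split=> //; apply: submodD.
by exists (r *: v'); rewrite (proj2 hl); split=> //; apply: submodZ.
Qed.

Variables (A B : V -> Prop) (A' B' : W -> Prop).
Hypotheses (sA : is_submod A) (sB : is_submod B) (sA' : is_submod A') (sB' : is_submod B').
Hypotheses (BA' : sub B' A') (AA' : forall v, A v -> A' (h v)).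
Hypothesis sur : forall w, A' w -> exists v, A v /\ B' (w - h v).
Hypothesis inj : forall v, A v -> B' (h v) <-> B v.
Hypothesis BA : sub B A.

Let push (X : V -> Prop) : W -> Prop := sadd (imgp X) B'.
Let pull (X : W -> Prop) : V -> Prop := fun v => A v /\ X (h v).

(** The hypotheses of the section say that [h] induces an isomorphism from A/B onto A'/B'. Image
    plus [B'] and preimage within [A] carry chains across and keep the steps strict. *)
Lemma iso_length n : is_length B A n <-> is_length B' A' n.
Proof.
have pushB : push B = B'.
  apply: pred_ext; last by apply: sub_saddr; apply: imgp_submod.
  by apply: sadd_sub => // w [v [Bv ->]]; apply/inj => //; apply: BA.
have pushA : push A = A'.
  apply: pred_ext; first by apply: sadd_sub => // w [v [Av ->]]; apply: AA'.
  move=> w /sur [v [Av Bw]]; exists (h v), (w - h v).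
  by rewrite [h v + _]addrC subrK; do !split=> //; exists v.
have pullB : pull B' = B.
  apply: pred_ext => [v [Av /inj]|v Bv]; first by apply.
  by split; [apply: BA|apply/inj => //; apply: BA].
have pullA : pull A' = A.
  by apply: pred_ext => [v []//|v Av]; split=> //; apply: AA'.
have fwd X k : pchain B X k -> sub X A -> pchain B' (push X) k.
  elim=> [_ _|X1 X2 {}k c IH s2 s ns s2A]; first by rewrite pushB; apply: pchain0.
  have s1A : sub X1 A by move=> v /s /s2A.
  apply: pchainS (IH s1A) _ _ _; first by apply: sadd_submod => //; apply: imgp_submod.
    by move=> w [a [b [[v [Xv ->]] [Bb ->]]]]; exists (h v), b; do !split=> //; exists v; split=> //; apply: s.
  move=> i; apply: ns => v Xv.
  have /i [a [b [[v1 [X1v ->]] [Bb e]]]] : push X2 (h v).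
    by apply: sub_saddl => //; exists v.
  have hX1 := pchain_submodr c.
  have : B (v - v1).
    apply/inj; first by apply: submodB => //; [apply: s2A|apply: s1A].
    by rewrite linB e addrC addKr.
  move/(pchain_sub c) => X1'; rewrite -(subrK v1 v); exact: submodD.
have bwd X k : pchain B' X k -> sub X A' -> pchain B (pull X) k.
  elim=> [_ _|X1 X2 {}k c IH s2 s ns s2A]; first by rewrite pullB; apply: pchain0.
  have s1A : sub X1 A' by move=> v /s /s2A.
  apply: pchainS (IH s1A) _ _ _.
  - by apply: (@scap_submod _ _ A (fun v => X2 (h v))) => //; apply: preim_submod.
  - by move=> v [Av Xv]; split=> //; apply: s.
  move=> i; apply: ns => w Xw; have [v [Av Bw]] := sur (s2A _ Xw).
  have hX1 := pchain_submodr c.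
  have Bw1 := pchain_sub c Bw.
  have /i [_ X1v] : pull X2 v.
    split=> //; rewrite -[h v](subKr w); apply: submodB => //.
    by apply: s.
  by rewrite -(subrK (h v) w); apply: submodD.
have fwd' k : pchain B A k -> pchain B' A' k by move=> c; rewrite -pushA; apply: fwd.
have bwd' k : pchain B' A' k -> pchain B A k by move=> c; rewrite -pullA; apply: bwd.
split=> /is_lengthP [c m]; apply/is_lengthP; split; eauto.
Qed.

(** The two epsilon choices are made from the same predicate, so the equality also covers infinite
    length. *)
Lemma iso_qlen : qlen B A = qlen B' A'.
Proof.
by rewrite /qlen; congr epsilon; apply: pred_ext => n /iso_length.
Qed.

End Transfer.

(** * Noetherian modules, primes and dimension *)

Section Noetherian.
Variable R : comNzRingType.

Definition noeth (V : lmodType R) :=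
  forall S : nat -> V -> Prop, (forall k, is_submod (S k)) ->
  (forall k, sub (S k) (S k.+1)) ->
  exists k0, forall k, (k0 <= k)%N -> sub (S k) (S k0).

(** If no member were maximal, epsilon would choose a strictly larger one each time, and the
    iterates would never stabilize. *)
Lemma noeth_max (V : lmodType R) (P : (V -> Prop) -> Prop) :
  noeth V -> (exists S, P S) -> (forall S, P S -> is_submod S) ->
  exists S, P S /\ forall S', P S' -> sub S S' -> sub S' S.
Proof.
move=> nV [S0 PS0] hP; apply: NNPP => hn.
pose nx S := epsilon (inhabits S) (fun S' => P S' /\ sub S S' /\ ~ sub S' S).
have nxP S : P S -> P (nx S) /\ sub S (nx S) /\ ~ sub (nx S) S.
  move=> PS; apply: (epsilon_spec (inhabits S) (fun S' => P S' /\ sub S S' /\ ~ sub S' S)).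
  apply: NNPP => hn'; apply: hn; exists S; split=> // S' PS' SS'.
  by apply: NNPP => nS; apply: hn'; exists S'.
pose c k := iter k nx S0.
have Pc k : P (c k) by elim: k => // k /nxP [].
have [k|k|k0 h] := nV c; [exact: hP|by have [_ []] := nxP _ (Pc k)|].
by have [_ [_]] := nxP _ (Pc k0); apply; apply: (h k0.+1).
Qed.

Lemma idl0 (I : R -> Prop) : is_ideal I -> I 0. Proof. by case. Qed.
Lemma idlD (I : R -> Prop) a b : is_ideal I -> I a -> I b -> I (a + b).
Proof. by move=> [_ [h _]]; apply: h. Qed.
Lemma idlMl (I : R -> Prop) r a : is_ideal I -> I a -> I (r * a).
Proof. by move=> [_ [_ h]]; apply: h. Qed.
Lemma idlMr (I : R -> Prop) r a : is_ideal I -> I a -> I (a * r).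
Proof. by rewrite mulrC; apply: idlMl. Qed.
Lemma idlN (I : R -> Prop) a : is_ideal I -> I a -> I (- a).
Proof. by move=> h Ia; rewrite -mulN1r; apply: idlMl. Qed.
Lemma idl_sum (I : R -> Prop) J (r : seq J) (P : pred J) (F : J -> R) :
  is_ideal I -> (forall i, P i -> I (F i)) -> I (\sum_(i <- r | P i) F i).
Proof.
move=> h hF; apply: big_ind => //; first exact: idl0.
by move=> u v; apply: idlD.
Qed.

Lemma prime_pow (P : R -> Prop) r k : is_prime_ideal P -> P (r ^+ k) -> P r.
Proof.
move=> [_ [n1 hp]]; elim: k => [//|k IH]; rewrite exprS => /hp[//|]; exact: IH.
Qed.

Lemma colon_ideal (V : lmodType R) (A L : V -> Prop) :
  is_submod A -> is_ideal (fun r => forall l, L l -> A (r *: l)).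
Proof.
move=> hA; split; first by move=> l _; rewrite scale0r; apply: submod0.
split=> [a b ha hb l Ll|r a ha l Ll].
  by rewrite scalerDl; apply: submodD => //; [apply: ha|apply: hb].
by rewrite -scalerA; apply: submodZ => //; apply: ha.
Qed.

Lemma quot_ann_ideal (V : lmodType R) (A : V -> Prop) :
  is_submod A -> is_ideal (fun r => forall v, A (r *: v)).
Proof.
move=> hA; suff <- : (fun r => forall l, full l -> A (r *: l)) = (fun r => forall v, A (r *: v)).
  exact: colon_ideal.
by apply: pred_ext => r h v; [apply: h|move=> _; apply: h].
Qed.

Lemma ann_ideal (V : lmodType R) : is_ideal (@ann R V).
Proof.
split; first by move=> v; rewrite scale0r.
split=> [a b ha hb v|r a ha v]; first by rewrite scalerDl ha hb addr0.
by rewrite -scalerA ha scaler0.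
Qed.

Definition iadd (I : R -> Prop) (a : R) : R -> Prop :=
  fun r => exists i c, I i /\ r = i + c * a.

Lemma iadd_ideal I a : is_ideal I -> is_ideal (iadd I a).
Proof.
move=> hI; split; first by exists 0, 0; rewrite mul0r addr0; split=> //; apply: idl0.
split=> [r s [i [c [Ii ->]]] [j [e [Ij ->]]]|t r [i [c [Ii ->]]]].
  by exists (i + j), (c + e); rewrite mulrDl addrACA; split=> //; apply: idlD.
by exists (t * i), (t * c); rewrite mulrDr mulrA; split=> //; apply: idlMl.
Qed.
Lemma sub_iadd I a : sub I (iadd I a).
Proof. by move=> i Ii; exists i, 0; rewrite mul0r addr0. Qed.
Lemma iadd_mem I a : is_ideal I -> iadd I a a.
Proof. by move=> hI; exists 0, 1; rewrite mul1r add0r; split=> //; apply: idl0. Qed.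

(** The generated ideal as an intersection: a property of its elements is proved by checking that it
    defines an ideal containing [G], without writing linear combinations. *)
Definition igen (G : R -> Prop) : R -> Prop :=
  fun r => forall I, is_ideal I -> sub G I -> I r.

Lemma igen_ideal G : is_ideal (igen G).
Proof.
split; first by move=> I hI _; apply: idl0.
split=> [a b ha hb I hI GI|r a ha I hI GI].
  by apply: idlD => //; [apply: ha|apply: hb].
by apply: idlMl => //; apply: ha.
Qed.
Lemma igen_mem G : sub G (igen G).
Proof. by move=> r Gr I _; apply. Qed.
Lemma igen_min G I : is_ideal I -> sub G I -> sub (igen G) I.
Proof. by move=> hI GI r; apply. Qed.
Lemma igen_mono G H : sub G H -> sub (igen G) (igen H).
Proof. by move=> GH; apply: igen_min; [apply: igen_ideal|move=> r /GH; apply: igen_mem]. Qed.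

(** This is [prime_chain] with a set [a], not necessarily an ideal, in place of the annihilator;
    adjoining a generator is then a mere disjunction. *)
Definition pch (a : R -> Prop) (c : nat -> R -> Prop) (k : nat) :=
  (forall i, (i <= k)%N -> is_prime_ideal (c i)) /\
  (forall i, (i < k)%N -> (forall r, c i r -> c i.+1 r) /\ exists r, c i.+1 r /\ ~ c i r) /\
  (forall r, a r -> c 0%N r).

(* dim R/(a) < k, with natural numbers so that no module of dimension -oo needs a special case *)
Definition dlt (a : R -> Prop) (k : nat) := forall c n, pch a c n -> (n < k)%N.

Lemma dlt_sub a b k : sub a b -> dlt a k -> dlt b k.
Proof. by move=> ab h c n [h1 [h2 h3]]; apply: (h c); split=> //; split=> // r /ab; apply: h3. Qed.

Lemma pch_cons a b c n q : pch b c n -> is_prime_ideal q -> sub a q ->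
  sub q (c 0%N) -> ~ sub (c 0%N) q ->
  pch a (fun i => if i is i'.+1 then c i' else q) n.+1.
Proof.
move=> [h1 [h2 h3]] hq aq qc /not_sub [r [cr nr]]; split; first by case=> // i; apply: h1.
by split=> // -[_|i /h2]; last by []; split=> //; exists r.
Qed.

Hypothesis nR : noetherian_ring R.

Lemma noeth_ring : noeth R^o.
Proof. exact: nR. Qed.

Lemma ideal_max (P : (R -> Prop) -> Prop) :
  (exists I, P I) -> (forall I, P I -> is_ideal I) ->
  exists I, P I /\ forall J, P J -> sub I J -> sub J I.
Proof. exact: noeth_max noeth_ring. Qed.

(** An ideal [I] maximal among those over [a] that miss [T] is prime: for x, y outside [I], both I +
    (x) and I + (y) meet [T], and the product of the two elements found would lie in [I] if xy
    did. *)
Lemma prime_avoiding (a T : R -> Prop) : is_ideal a -> T 1 ->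
  (forall s t, T s -> T t -> T (s * t)) -> (forall r, a r -> ~ T r) ->
  exists q, is_prime_ideal q /\ sub a q /\ forall r, q r -> ~ T r.
Proof.
move=> ha T1 TM aT.
pose P I := is_ideal I /\ sub a I /\ forall r, I r -> ~ T r.
have [||I [[hI [aI IT]] mx]] := @ideal_max P; [by exists a; split=> //; split|by move=> I []|].
have ex r : ~ I r -> exists i c, I i /\ T (i + c * r).
  move=> nr; apply: NNPP => hn; apply: nr.
  apply: (mx (iadd I r)); last exact: iadd_mem.
    split; first exact: iadd_ideal.
    split; first by move=> s /aI; apply: sub_iadd.
    by move=> s [i [c [Ii ->]]] Ts; apply: hn; exists i, c.
  exact: sub_iadd.
exists I; split=> //; split=> //; split; first by move/IT.
move=> x y Ixy; apply: NNPP => /not_or_and [/ex [i [c [Ii Ti]]] /ex [j [e [Ij Tj]]]].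
apply: (IT _ _ (TM _ _ Ti Tj)).
rewrite mulrDr; apply: idlD => //; first exact: idlMl.
rewrite mulrDl; apply: idlD => //; first exact: idlMr.
have -> : c * x * (e * y) = (c * e) * (x * y) by ring.
exact: idlMl.
Qed.

Lemma prime_exists (a : R -> Prop) : is_ideal a -> ~ a 1 ->
  exists q, is_prime_ideal q /\ sub a q.
Proof.
move=> ha n1; have [//|||q [? [? _]]] := @prime_avoiding a (fun r => r = 1) ha.
- by move=> s t -> ->; rewrite mulr1.
- by move=> r ar e; apply: n1; rewrite -e.
by exists q.
Qed.

Lemma dlt0 (a : R -> Prop) : is_ideal a -> dlt a 0 -> a 1.
Proof.
move=> ha h; apply: NNPP => /(prime_exists ha) [q [hq aq]].
suff /h : pch a (fun _ => q) 0 by [].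
by split=> //; split.
Qed.

(* A nonzerodivisor modulo b lies in no minimal prime of b: localize at c 0 and w. *)
Lemma dlt_drop (b : R -> Prop) w k : is_ideal b -> (forall s, b (w * s) -> b s) ->
  dlt b k -> dlt (fun r => b r \/ r = w) k.-1.
Proof.
move=> hb hw h c n hc; have [h1 [h2 h3]] := hc.
have [[c0 [cD cM]] [cn1 cp]] := h1 0%N (leq0n _).
pose T t := exists s j, ~ c 0%N s /\ t = s * w ^+ j.
have [|||q [hq [bq qT]]] := @prime_avoiding b T hb.
- by exists 1, 0%N; rewrite mulr1.
- move=> s t [s' [j [ns ->]]] [t' [j' [nt ->]]].
  exists (s' * t'), (j + j')%N; split; first by move/cp => [].
  by rewrite exprD mulrACA.
- move=> r br [s [j [ns e]]]; apply: ns; apply: h3; left.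
  elim: j r br e => [|j IH] r br e; first by rewrite mulr1 in e; rewrite -e.
  apply: (IH (s * w ^+ j)) => //; apply: hw; move: br; rewrite e exprS.
  by rewrite mulrCA.
have qc : sub q (c 0%N).
  by move=> r qr; apply: NNPP => nc; apply: (qT _ qr); exists r, 0%N; rewrite mulr1.
suff /h : pch b (fun i => if i is i'.+1 then c i' else q) n.+1 by lia.
apply: pch_cons hc hq bq qc _ => /(_ w) cq.
have /cq /qT : c 0%N w by apply: h3; right.
by apply; exists 1, 1%N; rewrite mul1r.
Qed.

(** A finite list that stands in for the minimal primes. A maximal counterexample [I] is not prime,
    so some xy lies in [I] with x, y outside; each prime over [I] contains x or y, and the lists for
    I + (x) and I + (y) are joined. *)
Lemma primes_below (a : R -> Prop) : is_ideal a ->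
  exists n (P : nat -> R -> Prop), (forall i, (i < n)%N -> is_prime_ideal (P i) /\ sub a (P i)) /\
  forall q, is_prime_ideal q -> sub a q -> exists i, (i < n)%N /\ sub (P i) q.
Proof.
pose good (a : R -> Prop) := exists n (P : nat -> R -> Prop),
  (forall i, (i < n)%N -> is_prime_ideal (P i) /\ sub a (P i)) /\
  forall q, is_prime_ideal q -> sub a q -> exists i, (i < n)%N /\ sub (P i) q.
move=> ha; apply: NNPP => nga.
have [||I [[hI ngI] mx]] := @ideal_max (fun I => is_ideal I /\ ~ good I).
- by exists a.
- by move=> I [].
apply: ngI; have [I1|nI1] := classic (I 1).
  exists 0%N, (fun _ => I); split=> // q [_ [nq1 _]] /(_ 1 I1) q1.
  by case: nq1.
have [pI|npI] := classic (is_prime_ideal I).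
  by exists 1%N, (fun _ => I); split=> // q _ Iq; exists 0%N.
have [x [y [Ixy [nx ny]]]] : exists x y, I (x * y) /\ ~ I x /\ ~ I y.
  apply: NNPP => hn; apply: npI; split=> //; split=> //.
  move=> x y Ixy; apply: NNPP => /not_or_and [? ?]; apply: hn.
  by exists x, y.
have gd z : ~ I z -> good (iadd I z).
  move=> nz; apply: NNPP => ng; apply: nz.
  apply: (mx (iadd I z)); last exact: iadd_mem.
    by split=> //; apply: iadd_ideal.
  exact: sub_iadd.
have [n1 [P1 [hP1 c1]]] := gd _ nx; have [n2 [P2 [hP2 c2]]] := gd _ ny.
exists (n1 + n2)%N, (fun i => if (i < n1)%N then P1 i else P2 (i - n1)%N); split.
  move=> i lt; case: ifP => [/hP1|nlt] ; [|have /hP2 : (i - n1 < n2)%N by lia];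
  by move=> [? s]; split=> // r Ir; apply: s; apply: sub_iadd.
move=> q hq Iq; have [hqi [_ qp]] := hq.
have inq z : q z -> sub (iadd I z) q.
  move=> qz r [i [e [/Iq qi ->]]]; apply: idlD => //; exact: idlMl.
have [/inq qx|/inq qy] := qp _ _ (Iq _ Ixy).
  by have [i [lt s]] := c1 q hq qx; exists i; rewrite lt; split=> //; lia.
have [i [lt s]] := c2 q hq qy; exists (n1 + i)%N; split; first lia.
by rewrite ltnNge leq_addr addKn.
Qed.

(** Primes contained in [P n] are avoided along with it, so only the others, selected by [Q'], enter
    the induction. If the resulting [c] falls into [P n], it is corrected by [b0 * e], with [e] in
    all the others but outside [P n]. *)
Lemma prime_avoidance (b : R -> Prop) n (P : nat -> R -> Prop) (Q : nat -> Prop) :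
  is_ideal b -> (forall i, (i < n)%N -> Q i -> is_prime_ideal (P i) /\ ~ sub b (P i)) ->
  exists c, b c /\ forall i, (i < n)%N -> Q i -> ~ P i c.
Proof.
move=> hb; elim: n Q => [|n IH] Q h; first by exists 0; split=> //; apply: idl0.
pose Q' i := Q i /\ ~ sub (P i) (P n) /\ Q n.
have [Qn|nQn] := classic (Q n); last first.
  have [|c [bc hc]] := IH Q; first by move=> i lt; apply: h; lia.
  exists c; split=> // i; rewrite ltnS leq_eqVlt => /orP[/eqP-> //|lt]; exact: hc.
have [pn nb] := h n (ltnSn n) Qn.
have [|c [bc hc]] := IH Q'; first by move=> i lt [Qi _]; apply: h => //; lia.
suff [c' [bc' [nc' hc']]] : exists c', b c' /\ ~ P n c' /\ forall i, (i < n)%N -> Q' i -> ~ P i c'.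
  exists c'; split=> // i; rewrite ltnS leq_eqVlt => /orP[/eqP-> //|lt] Qi.
  have [s|ns] := classic (sub (P i) (P n)); first by move/s.
  exact: hc'.
have [Pc|nPc] := classic (P n c); last by exists c.
have [b0 [bb0 nb0]] := not_sub nb.
have [pnI [pn1 pnp]] := pn.
have [e [ne he]] : exists e, ~ P n e /\ forall i, (i < n)%N -> Q' i -> P i e.
  have : forall k, (k <= n)%N -> exists e, ~ P n e /\ forall i, (i < k)%N -> Q' i -> P i e.
    elim=> [_|k IHk lt]; first by exists 1.
    have [e [ne he]] := IHk (ltnW lt).
    have [Qk|nQk] := classic (Q' k); last first.
      exists e; split=> // i; rewrite ltnS leq_eqVlt => /orP[/eqP-> //|]; exact: he.
    have [_ [/not_sub [z [Pz nz]] _]] := Qk.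
    exists (z * e); split; first by move/pnp => [].
    move=> i lti Qi; have [[hPi _] _] := h i (leq_trans lti (leqW lt)) (proj1 Qi).
    have [ltk|gek] := ltnP i k; last first.
      have ik : i = k by lia.
      by subst i; apply: idlMr.
    by apply: idlMl => //; apply: he.
  by move=> /(_ n (leqnn n)).
exists (c + b0 * e); split; first by apply: idlD => //; apply: idlMr.
split.
  move=> pc; have : P n (b0 * e).
    by rewrite -(addKr c (b0 * e)); apply: idlD => //; apply: idlN.
  by move/pnp => [].
move=> i lt Qi pc; apply: (hc i lt Qi).
have [[hPi _] _] := h i (leqW lt) (proj1 Qi).
rewrite -(addrK (b0 * e) c); apply: idlD => //; apply: idlN => //.
by apply: idlMl => //; apply: he.
Qed.

(** The element [c] avoids the listed primes that do not contain [b]. A chain over a + (c) starts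
    above some listed [P i]: if [P i] contains [b], it is a chain over a + b; otherwise [P i] can be
    prepended to it. *)
Lemma parameter_exists (a b : R -> Prop) k : is_ideal a -> is_ideal b ->
  dlt a k.+1 -> dlt (fun r => a r \/ b r) k ->
  exists c, b c /\ dlt (fun r => a r \/ r = c) k.
Proof.
move=> ha hb da dab.
have [n [P [hP cov]]] := primes_below ha.
have [|c [bc hc]] := @prime_avoidance b n P (fun i => ~ sub b (P i)) hb.
  by move=> i /hP [].
exists c; split=> // ch l hch; have [h1 [h2 h3]] := hch.
have a0 : sub a (ch 0%N) by move=> r ar; apply: h3; left.
have [i [lt s]] := cov _ (h1 0%N (leq0n _)) a0.
have [pi api] := hP i lt.
have [bP|nbP] := classic (sub b (P i)).
  by apply: (dab ch); split=> //; split=> // r [/a0 //|/bP /s].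
suff /da : pch a (fun i' => if i' is i''.+1 then ch i'' else P i) l.+1 by [].
apply: pch_cons hch _ _ s _ => // /(_ c) h.
by apply: (hc i lt nbP); apply: h; apply: h3; right.
Qed.

(** Induction on the generators: the coefficients at [e] modulo the span of the others form an
    ascending chain of ideals, and once this chain and the intersections with that span are stable,
    so is [S]. *)
Lemma fg_noeth (V : lmodType R) : fin_gen V -> noeth V.
Proof.
pose spn := fix spn (s : seq V) (v : V) : Prop :=
  if s is e :: s' then exists r, spn s' (v - r *: e) else v = 0.
have spn_sub s : is_submod (spn s).
  elim: s => [|e s IH] /=; first exact: null_submod.
  split; first by exists 0; rewrite scale0r subr0; apply: submod0.
  split=> [u v [r hr] [t ht]|a v [r hr]].
    exists (r + t); rewrite scalerDl opprD addrACA; exact: submodD.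
  by exists (a * r); rewrite -scalerA -scalerBr; apply: submodZ.
have key s (S : nat -> V -> Prop) : (forall k, is_submod (S k)) ->
  (forall k, sub (S k) (S k.+1)) -> (forall k, sub (S k) (spn s)) ->
  exists k0, forall k, (k0 <= k)%N -> sub (S k) (S k0).
  elim: s S => [|e s IH] S hS asc hs.
    by exists 0%N => k _ v /hs ->; apply: submod0.
  have mono i j : (i <= j)%N -> sub (S i) (S j).
    by move=> /subnK <-; elim: (j - i)%N => [v //|l IHl v /IHl]; apply: asc.
  pose I k r := exists u, spn s u /\ S k (r *: e + u).
  have [||k1 h1] := nR (I := I).
  - move=> k; split.
      by exists 0; rewrite scale0r addr0; split; apply: submod0.
    split=> [a b [u [su Su]] [v [sv Sv]]|r a [u [su Su]]].
      exists (u + v); split; first exact: submodD.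
      by rewrite scalerDl addrACA; apply: submodD.
    exists (r *: u); split; first exact: submodZ.
    by rewrite -scalerA -scalerDr; apply: submodZ.
  - by move=> k a [u [su Su]]; exists u; split=> //; apply: asc.
  have [|||k2 h2] := IH (fun k => scap (S k) (spn s)).
  - by move=> k; apply: scap_submod.
  - by move=> k v [Sv sv]; split=> //; apply: asc.
  - by move=> k v [].
  exists (maxn k1 k2) => k le v Sv.
  have [r hr] := hs k v Sv.
  have [|u [su Su]] := h1 k (leq_trans (leq_maxl _ _) le) r.
    by exists (v - r *: e); rewrite [_ + (v - _)]addrC subrK.
  have Su' := mono _ _ (leq_maxl k1 k2) _ Su.
  rewrite -(subrK (r *: e + u) v); apply: submodD => //.
  apply: (mono k2); first exact: leq_maxr.
  suff [] : scap (S k2) (spn s) (v - (r *: e + u)) by [].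
  apply: (h2 k); first exact: leq_trans (leq_maxr _ _) le.
  split; last by rewrite opprD addrA; apply: submodB.
  apply: submodB => //; apply: mono Su; exact: leq_trans (leq_maxl _ _) le.
move=> [s hs] S hS asc; apply: (key s) => // k v _.
have [rs [_ ->]] := hs v; apply: submod_sum => // i _; apply: submodZ => //.
elim: s i {hs} => [[]//|e s IH] [[|i] lt] /=.
  by exists 1; rewrite scale1r subrr; apply: submod0.
by exists 0; rewrite scale0r subr0; apply: (IH (Ordinal (lt : (i < size s)%N))).
Qed.

(** * Local rings: Nakayama, finite length and unmixedness *)

Variable m : R -> Prop.
Hypothesis lm : local_ring_with m.

Lemma m_ideal : is_ideal m. Proof. by case: lm => [[]]. Qed.

Lemma proper_sub_m (I : R -> Prop) : is_ideal I -> ~ I 1 -> sub I m.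
Proof.
move=> hI n1.
have [||J [[hJ [IJ nJ]] mx]] := @ideal_max (fun J => is_ideal J /\ sub I J /\ ~ J 1).
- by exists I; split=> //; split.
- by move=> J [].
have [_ /(_ J) h] := lm.
suff /h eJ : is_maximal_ideal J by move=> r /IJ /eJ.
split=> //; split=> // K hK JK nK; apply: mx => //.
by split=> //; split=> // r /IJ /JK.
Qed.

Lemma unit_notin_m r : ~ m r -> exists s, s * r = 1.
Proof.
move=> nm; apply: NNPP => hn; apply: nm.
apply: (@proper_sub_m (fun x => exists s, x = s * r)); last by exists 1; rewrite mul1r.
  split; first by exists 0; rewrite mul0r.
  split=> [a b [s ->] [t ->]|c a [s ->]]; first by exists (s + t); rewrite mulrDl.
  by exists (c * s); rewrite mulrA.
by move=> [s e]; apply: hn; exists s.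
Qed.

Lemma m_proper : ~ m 1. Proof. by case: lm => [[_ []]]. Qed.

Lemma m_prime : is_prime_ideal m.
Proof.
split; first exact: m_ideal.
split=> [|a b mab]; first exact: m_proper.
have [ma|/unit_notin_m [s e]] := classic (m a); first by left.
right; rewrite -[b]mul1r -e -mulrA; apply: idlMl => //; exact: m_ideal.
Qed.

Lemma prime_sub_m q : is_prime_ideal q -> sub q m.
Proof. by move=> [hq [n1 _]]; apply: proper_sub_m. Qed.

(** Otherwise some prime over [a] misses every power of [r]; it lies strictly below [m] and gives a
    chain with two members. *)
Lemma nil_of_dlt1 (a : R -> Prop) r : is_ideal a -> dlt a 1 -> m r -> exists k, a (r ^+ k).
Proof.
move=> ha da mr; apply: NNPP => hn.
have [|||q [hq [aq qT]]] := @prime_avoiding a (fun t => exists k, t = r ^+ k) ha.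
- by exists 0%N.
- by move=> s t [i ->] [j ->]; exists (i + j)%N; rewrite exprD.
- by move=> s as_ [k e]; apply: hn; exists k; rewrite -e.
have h0 : pch m (fun _ => m) 0 by split=> [i _|]; [apply: m_prime|split].
have /da : pch a (fun i => if i is i'.+1 then m else q) 1; last by [].
apply: pch_cons h0 hq aq (prime_sub_m hq) _ => /(_ r mr) qr.
by apply: (qT _ qr); exists 1%N.
Qed.

Lemma dlt1_of_nil (a : R -> Prop) :
  (forall r, m r -> exists k, igen a (r ^+ k)) -> dlt a 1.
Proof.
move=> h c [//|n] [h1 [h2 h3]]; exfalso.
have [_ [r [c1 n0]]] := h2 0%N isT.
apply: n0; have p0 := h1 0%N isT; have [hp0 _] := p0.
have /h [k hk] := prime_sub_m (h1 1%N isT) c1.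
by apply: (prime_pow p0 (k := k)); apply: (igen_min hp0 h3).
Qed.

Lemma one_sub_unit r : m r -> exists s, s * (1 - r) = 1.
Proof.
move=> mr; apply: unit_notin_m => m1; apply: m_proper.
by rewrite -(subrK r 1); apply: idlD => //; apply: m_ideal.
Qed.

Section Modules.
Variable V : lmodType R.

Definition addcyc (X : V -> Prop) (u : V) : V -> Prop :=
  fun v => exists c x, X x /\ v = c *: u + x.

Lemma addcyc_submod X u : is_submod X -> is_submod (addcyc X u).
Proof.
move=> hX; split; first by exists 0, 0; rewrite scale0r addr0; split=> //; apply: submod0.
split=> [v w [c [x [Xx ->]]] [e [z [Xz ->]]]|s v [c [x [Xx ->]]]].
  by exists (c + e), (x + z); rewrite scalerDl addrACA; split=> //; apply: submodD.
by exists (s * c), (s *: x); rewrite scalerDr scalerA; split=> //; apply: submodZ.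
Qed.

Lemma sub_addcyc X u : sub X (addcyc X u).
Proof. by move=> x Xx; exists 0, x; rewrite scale0r add0r. Qed.

Lemma addcyc_mem X u : is_submod X -> addcyc X u u.
Proof. by move=> hX; exists 1, 0; rewrite scale1r addr0; split=> //; apply: submod0. Qed.

Hypothesis nV : noeth V.

(* Take X maximal among the submodules over Q that do not contain P. *)
Lemma nakayama (P Q : V -> Prop) r : is_submod P -> is_submod Q -> m r ->
  (forall p, P p -> exists p' q, P p' /\ Q q /\ p = r *: p' + q) -> sub P Q.
Proof.
move=> hP hQ mr h; apply: NNPP => nPQ.
have [||X [[hX [QX nPX]] mx]] :=
  @noeth_max V (fun X => is_submod X /\ sub Q X /\ ~ sub P X) nV.
- by exists Q; split=> //; split.
- by move=> X [].
have [p [Pp nXp]] := not_sub nPX.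
pose Y := addcyc X p; have hY : is_submod Y := addcyc_submod p hX.
have XY : sub X Y := @sub_addcyc X p; have Yp : Y p := addcyc_mem p hX.
have PY : sub P Y.
  apply: NNPP => nPY; apply: nXp; apply: (mx Y) => //; split=> //; split=> // v /QX.
  exact: XY.
have [p' [q [/PY [c [x [Xx ->]]] [/QX Xq e]]]] := h p Pp.
apply: nXp; have [|s es] := @one_sub_unit (r * c).
  by apply: idlMr => //; apply: m_ideal.
rewrite -[p]scale1r -es -scalerA; apply: submodZ => //.
have -> : (1 - r * c) *: p = r *: x + q.
  rewrite scalerBl scale1r; apply/eqP; rewrite subr_eq; apply/eqP.
  by rewrite [LHS]e scalerDr scalerA [RHS]addrC addrA.
by apply: submodD => //; apply: submodZ.
Qed.

(** Take [A] maximal among the submodules of finite length over [B]. If it is not all of V, a vector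
    outside [A] with maximal colon ideal is killed by [m] modulo [A], and adding it is one simple
    step further. *)
Lemma finlen_of_nil (B : V -> Prop) : is_submod B ->
  (forall r, m r -> forall v, exists k, B (r ^+ k *: v)) -> finlen B (@full V).
Proof.
move=> hB hnil.
have [||A [[hA [BA fA]] mx]] :=
  @noeth_max V (fun A => is_submod A /\ sub B A /\ finlen B A) nV.
- by exists B; split=> //; split=> //; apply: finlenxx.
- by move=> X [].
have [fu|nfu] := classic (sub (@full V) A).
  by rewrite (pred_ext fu (fun v _ => I)).
exfalso; have [v [_ nAv]] := not_sub nfu.
pose Q (J : R -> Prop) := exists u, ~ A u /\ J = (fun r => A (r *: u)).
have hQ u : is_ideal (fun r => A (r *: u)).
  have -> : (fun r => A (r *: u)) = (fun r => forall l, l = u -> A (r *: l)).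
    by apply: pred_ext => [r Ar l ->|r /(_ _ erefl)].
  exact: colon_ideal.
have [||J [[u [nAu eJ]] mxJ]] := @ideal_max Q.
- by exists (fun r => A (r *: v)), v.
- by move=> J [u [_ ->]].
(* If r u is outside [A], so is every r^k u: the colon ideal of r^k u contains the maximal [J],
   hence equals it, and [r] is not in [J]. This contradicts nilpotency. *)
have mu r : m r -> A (r *: u).
  move=> mr; apply: NNPP => nr.
  have all_k k : ~ A (r ^+ k *: u).
    elim: k => [|k IH]; first by rewrite scale1r.
    rewrite exprS -scalerA => Ak; apply: nr.
    suff : J r by rewrite eJ.
    apply: (mxJ (fun s => A (s *: (r ^+ k *: u)))) => //; first by exists (r ^+ k *: u).
    move=> s; rewrite eJ scalerA mulrC -scalerA; exact: submodZ.
  by have [k /BA hk] := hnil r mr u; apply: (all_k k).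
pose Y := addcyc A u; have hY : is_submod Y := addcyc_submod u hA.
have AY : sub A Y := @sub_addcyc A u; have Yu : Y u := addcyc_mem u hA.
have dich X : is_submod X -> sub A X -> sub X Y -> ~ sub X A -> sub Y X.
  move=> hX AX XY /not_sub [x [Xx nAx]].
  have [c [a [Aa e]]] := XY x Xx.
  have [mc|/unit_notin_m [s es]] := classic (m c).
    by case: nAx; rewrite e; apply: submodD => //; apply: mu.
  have Xu : X u.
    rewrite -[u]scale1r -es -scalerA; apply: submodZ => //.
    by rewrite -(addrK a (c *: u)) -e; apply: submodB => //; apply: AX.
  move=> w [t [a' [Aa' ->]]]; apply: submodD => //; first exact: submodZ.
  exact: AX.
have fAY : finlen A Y.
  apply: (@finlen_bound _ _ _ _ 1) => // k.
  have gen X : X = Y -> pchain A X k -> (k <= 1)%N; last exact: gen.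
  move=> eX hc; case: hc eX => // X1 X2 n h hX2 s ns eX.
  case: h s ns => // X3 X4 n' h' hX4 s' ns' s ns; case: ns; rewrite eX.
  rewrite eX in s; have A3 := pchain_sub h'.
  apply: dich => //; first by move=> w /A3 /s'.
  by move=> X4A; apply: ns' => w /X4A /A3.
apply: nAu; apply: (mx Y) => //; split=> //; split; first by move=> w /BA /AY.
exact: finlen_add fA fAY.
Qed.

(** A weakly regular sequence on V/B; dividing out an element enlarges [B] instead of changing the
    module. *)
Fixpoint regB (B : V -> Prop) (w : seq R) : Prop :=
  if w is a :: w' then (forall v, B (a *: v) -> B v) /\ regB (sadd B (simg V a)) w' else True.

(* Saturate L with respect to the first element of the regular sequence; by Nakayama the saturation survives modulo that element, and the dimension drops. *)
Lemma unmixed w (B L : V -> Prop) (b : R -> Prop) :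
  is_submod B -> is_submod L -> (forall a, a \in w -> m a) -> regB B w ->
  ~ sub L B -> (forall r l, b r -> L l -> B (r *: l)) -> ~ dlt b (size w).
Proof.
elim: w B L b => [|a w IH] B L b hB hL wm reg nLB bL db.
  apply: nLB => l Ll.
  have /(dlt0 (colon_ideal L hB)) : dlt (fun r => forall l, L l -> B (r *: l)) 0.
    by apply: dlt_sub db => r br l' Ll'; apply: bL.
  by move=> /(_ _ Ll); rewrite scale1r.
have [rega regw] := reg.
have rega_k k v : B (a ^+ k *: v) -> B v.
  elim: k v => [|k IHk] v; first by rewrite scale1r.
  by rewrite exprSr -scalerA => /IHk; apply: rega.
pose L' u := exists k, sadd L B (a ^+ k *: u).
have hLB := sadd_submod hL hB.
have hL' : is_submod L'.
  split; first by exists 0%N; rewrite scaler0; apply: submod0.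
  split=> [u v [k hk] [j hj]|r v [k hk]].
    exists (k + j)%N; rewrite scalerDr; apply: submodD => //.
      by rewrite addnC exprD -scalerA; apply: submodZ.
    by rewrite exprD -scalerA; apply: submodZ.
  by exists k; rewrite scalerA mulrC -scalerA; apply: submodZ.
(* The annihilator of [L'] modulo [B]. It contains [b] because powers of [a] cancel on V/B, and for
   the same reason [a] is a nonzerodivisor modulo it, so adjoining [a] lowers the dimension. *)
pose b' r := forall l, L' l -> B (r *: l).
have bb' : sub b b'.
  move=> r br l [k [l' [c [Ll' [Bc e]]]]]; apply: (rega_k k).
  rewrite scalerA mulrC -scalerA e scalerDr; apply: submodD => //; first exact: bL.
  exact: submodZ.
have hb' : is_ideal b' by apply: colon_ideal.
have ha : m a by apply: wm; rewrite inE eqxx.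
have drop := @dlt_drop b' a (size w).+1 hb'.
apply: (IH (sadd B (simg V a)) L' (fun r => b' r \/ r = a)) => //.
- by apply: sadd_submod => //; apply: simg_submod.
- by move=> c cw; apply: wm; rewrite inE cw orbT.
- move=> h; apply: nLB => l Ll.
  suff: sub L' B by apply; exists 0%N; rewrite scale1r; apply: sub_saddl.
  apply: (nakayama (r := a)) => // p L'p.
  have [c [q [Bc [[u ->] e]]]] := h _ L'p.
  exists u, c; rewrite addrC; do !split=> //.
  have [k hk] := L'p; exists k.+1; rewrite exprSr -scalerA.
  have -> : a *: u = p - c by rewrite e addrC addKr.
  rewrite scalerBr; apply: submodB => //.
  by apply: sub_saddr => //; apply: submodZ.
- move=> r l [b'r|->] L'l; first by apply: sub_saddl; [apply: simg_submod|apply: b'r].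
  by apply: sub_saddr => //; exists l.
apply: drop; last exact: dlt_sub db.
move=> s hs l L'l; apply: rega; rewrite scalerA; exact: hs.
Qed.

End Modules.
End Noetherian.

(** * Koszul homology *)

Section Koszul.
Variables (R : comNzRingType) (V : lmodType R).

Fixpoint kos (n : nat) : lmodType R :=
  if n is n'.+1 then (kos n' * kos n')%type : lmodType R else V.

(* The Koszul differential, with kos n.+1 read as K(s) + K(s)[-1]. *)
Fixpoint kd (s : seq R) : kos (size s) -> kos (size s) :=
  match s with
  | [::] => fun _ => 0
  | y :: s' => fun u => (kd u.1 + y *: u.2, - kd u.2)
  end.

(** Since [kos] is the total module of the complex, degree is a predicate; the second summand
    carries the shift by one. *)
Fixpoint homog n (i : nat) : kos n -> Prop :=
  match n with
  | 0 => fun u => (0 < i)%N -> u = 0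
  | n'.+1 => fun u => homog i u.1 /\ (if i is i'.+1 then homog i' u.2 else u.2 = 0)
  end.

(** All coordinates lie in [B]; the Koszul complex of V/B is [kos] read modulo [kin B]. *)
Fixpoint kin (B : V -> Prop) n : kos n -> Prop :=
  match n with
  | 0 => fun u => B u
  | n'.+1 => fun u => kin B u.1 /\ kin B u.2
  end.

Lemma kd_linear s : is_linear (@kd s).
Proof.
elim: s => [|y s [IH1 IH2]] /=.
  by split=> [u v|r v]; rewrite ?addr0 ?scaler0.
split=> [[u1 u2] [v1 v2]|r [v1 v2]] /=; congr pair.
- by rewrite IH1 scalerDr addrACA.
- by rewrite IH1 opprD.
- by rewrite IH2 scalerDr !scalerA [y * r]mulrC.
- by rewrite IH2 scalerN.
Qed.

Lemma kdK s (u : kos (size s)) : kd (kd u) = 0.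
Proof.
elim: s u => [u|y s IH [u v]] //=.
have [hD hZ] := kd_linear s.
have hN w : @kd s (- w) = - kd w by rewrite -scaleN1r hZ scaleN1r.
by rewrite hD hZ !hN !IH !oppr0 add0r scalerN subrr.
Qed.

Lemma kin_submod B n : is_submod B -> is_submod (@kin B n).
Proof.
move=> hB; elim: n => [//|n IH] /=; split; first by split; apply: submod0.
split=> [u v [? ?] [? ?]|r v [? ?]]; split; do ?[exact: submodD|exact: submodZ].
Qed.

Lemma homog_submod n i : is_submod (@homog n i).
Proof.
elim: n i => [|n IH] i /=.
  split=> //; split=> [u v hu hv /[dup] /hu -> /hv ->|r v hv /hv ->]; rewrite ?addr0 ?scaler0 //.
case: i => [|i]; (split; first by split=> //; apply: submod0).
  split=> [u v [? eu] [? ev]|r v [? ev]] /=; split; do ?[exact: submodD|exact: submodZ].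
    by rewrite eu ev addr0.
  by rewrite ev scaler0.
by split=> [u v [? ?] [? ?]|r v [? ?]] /=; split; do ?[exact: submodD|exact: submodZ].
Qed.

Lemma homog_big n i (u : kos n) : (n < i)%N -> homog i u -> u = 0.
Proof.
elim: n i u => [|n IH] i u /= lt; first by apply.
case: i u lt => // i [u v] /= lt [hu hv].
have -> : u = 0 by apply: (IH i.+1) => //; apply: ltnW.
by have -> : v = 0 by apply: (IH i).
Qed.

Lemma kin_kd B s (u : kos (size s)) : is_submod B -> kin B u -> kin B (kd u).
Proof.
move=> hB; elim: s u => [|y s IH] u /=; first by move=> _; apply: submod0.
have hk n := @kin_submod B n hB.
move=> [? ?]; split; last by apply: submodN => //; apply: IH.
by apply: submodD => //; [apply: IH|apply: submodZ].
Qed.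

Lemma homog0_kd s (u : kos (size s)) : homog 0 u -> kd u = 0.
Proof.
elim: s u => [u|y s IH [u v]] //= [/IH -> ->].
by rewrite scaler0 addr0 (lin0 (kd_linear s)) oppr0.
Qed.

Lemma homog_kd i s (u : kos (size s)) : homog i.+1 u -> homog i (kd u).
Proof.
elim: s i u => [|y s IH] i u //=.
have hk n j := @homog_submod n j.
move=> [h1 h2]; split; first by apply: submodD => //; [apply: IH|apply: submodZ].
case: i h1 h2 => [|i] _ h2; first by rewrite homog0_kd ?oppr0.
by apply: submodN => //; apply: IH.
Qed.

(** For the head of [s] the homotopy is the exterior product with its basis vector, which moves the
    first component to the second; for later elements it is extended with a sign. *)
Lemma kd_homotopy s y : y \in s -> exists h : kos (size s) -> kos (size s),
  [/\ is_linear h, forall u, kd (h u) + h (kd u) = y *: u,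
     forall i u, homog i u -> homog i.+1 (h u) &
     forall B u, is_submod B -> kin B u -> kin B (h u)].
Proof.
elim: s => [//|a s IH]; rewrite inE; have [<- _|_ /= /IH [h [[hD hZ] hk hd hB]]] := eqVneq.
  exists (fun u => (0, u.1)); split=> /=.
  - by split=> [[u u'] [v v']|r [v v']] /=; congr pair; rewrite ?addr0 ?scaler0.
  - by move=> [u v] /=; rewrite (lin0 (kd_linear s)) add0r; congr pair; rewrite /= ?addr0 ?addKr.
  - move=> i [u v] /= [hu _]; split=> //; exact: submod0 (homog_submod _ _).
  - by move=> B [u v] hB /= [? _]; split=> //; apply: submod0 (kin_submod _ hB).
have hN w : h (- w) = - h w by rewrite -scaleN1r hZ scaleN1r.
have [dD dZ] := kd_linear s.
have dN w : @kd s (- w) = - kd w by rewrite -scaleN1r dZ scaleN1r.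
exists (fun u => (h u.1, - h u.2)); split=> /=.
- split=> [[u u'] [v v']|r [v v']] /=; congr pair; rewrite ?hD ?hZ ?opprD ?scalerN //.
- move=> [u v] /=; congr pair => /=.
    by rewrite hD hZ addrACA scalerN addNr addr0 hk.
  by rewrite dN hN !opprK hk.
- move=> i [u v] /= [hu hv]; split; first exact: hd.
  case: i hv {hu} => [->|i hv]; last by apply: submodN; [apply: homog_submod|apply: hd].
  by rewrite -(scale0r 0) hZ scale0r oppr0; apply: submod0 (homog_submod _ _).
- move=> B [u v] sB /= [? ?]; split; first exact: hB.
  by apply: submodN; [apply: kin_submod|apply: hB].
Qed.

Lemma kin_split B c n i (e : kos n) : is_submod B -> homog i e ->
  kin (sadd B (simg V c)) e -> exists u, homog i u /\ kin B (e - c *: u).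
Proof.
move=> hB; elim: n i e => [|n IH] i e /=.
  move=> he [b [_ [Bb [[u ->] ee]]]].
  have [i0|/he e0] := posnP i; last first.
    by exists 0; rewrite e0 scaler0 subrr; split=> //; apply: submod0.
  by exists u; split=> //; rewrite ee addrK.
case: e => e1 e2 /= [h1 h2] [/(IH _ _ h1) [u1 [hu1 k1]] k2].
have [u2 [hu2 k2']] : exists u2, (if i is i'.+1 then homog i' u2 else u2 = 0) /\ kin B (e2 - c *: u2).
  case: i h1 h2 hu1 => [|i] h1 h2 hu1; last exact: IH.
  by exists 0; rewrite h2 scaler0 subrr; split=> //; apply: submod0 (kin_submod _ hB).
by exists (u1, u2).
Qed.

Lemma kin_reg B c n (e : kos n) : (forall v, B (c *: v) -> B v) ->
  kin B (c *: e) -> kin B e.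
Proof. by move=> hc; elim: n e => [|n IH] e /=; [apply: hc|move=> [? ?]; split; apply: IH]. Qed.

Lemma kin_ann (B : V -> Prop) a n (e : kos n) : (forall v, B (a *: v)) -> kin B (a *: e).
Proof. by move=> ha; elim: n e => [|n IH] e /=; [apply: ha|split; apply: IH]. Qed.

Lemma kin_sub (B B' : V -> Prop) n (e : kos n) : sub B B' -> kin B e -> kin B' e.
Proof. by move=> BB'; elim: n e => [|n IH] e /=; [apply: BB'|move=> [? ?]; split; apply: IH]. Qed.

(** The elements that act as zero on the Koszul homology of V/B form an ideal; it contains the
    annihilator of V/B and, by the homotopies, all of [s]. *)
Lemma koszul_kill (B : V -> Prop) s a i (u : kos (size s)) : is_submod B ->
  igen (fun r => (forall v : V, B (r *: v)) \/ r \in s) a ->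
  homog i u -> kin B (kd u) -> exists u', homog i.+1 u' /\ kin B (a *: u - kd u').
Proof.
move=> hB ha hu ku; move: a ha; have [dD dZ] := kd_linear s.
have hk := kin_submod (size s) hB; have hh := homog_submod (size s) i.+1.
apply: igen_min.
  split; first by exists 0; rewrite scale0r (lin0 (kd_linear s)) subr0; split; apply: submod0.
  split=> [a b [v [hv kv]] [w [hw kw]]|r a [v [hv kv]]].
    exists (v + w); split; first exact: submodD.
    by rewrite dD scalerDl opprD addrACA; apply: submodD.
  exists (r *: v); split; first exact: submodZ.
  by rewrite dZ -scalerA -scalerBr; apply: submodZ.
move=> a [ha|/kd_homotopy [h [_ ek hd hB']]].
  by exists 0; rewrite (lin0 (kd_linear s)) subr0; split; [apply: submod0|apply: kin_ann].
exists (h u); split; first exact: hd.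
by rewrite -ek addrC addKr; apply: hB'.
Qed.

(** Depth sensitivity. Vanishing one degree higher on V/(B + aV) makes [a] injective on the homology
    of V/B in degree [i], while a power of [a] kills that homology. *)
Lemma koszul_exact (m : R -> Prop) s w (B : V -> Prop) i (u : kos (size s)) : is_submod B ->
  (forall r, m r -> exists k, igen (fun r => (forall v : V, B (r *: v)) \/ r \in s) (r ^+ k)) ->
  (forall a, a \in w -> m a) -> regB B w -> (size s < i + size w)%N ->
  homog i u -> kin B (kd u) -> exists u', homog i.+1 u' /\ kin B (u - kd u').
Proof.
elim: w B i u => [|a w IH] B i u hB nil wm reg lt hu ku.
  have -> : u = 0 by apply: homog_big hu; rewrite addn0 in lt.
  exists 0; rewrite (lin0 (kd_linear s)) subr0.
  by split; apply: submod0; [apply: homog_submod|apply: kin_submod].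
have [dD dZ] := kd_linear s; have hk := kin_submod (size s) hB.
have [rega regw] := reg.
have hB' : is_submod (sadd B (simg V a)) by apply: sadd_submod => //; apply: simg_submod.
have BB' : sub B (sadd B (simg V a)) by apply: sub_saddl; apply: simg_submod.
have [k hk'] := nil a (wm a (mem_head _ _)).
have [u0 [hu0 ku0]] := koszul_kill hB hk' hu ku.
(* From a^(k+1) u = d u0 modulo [B]: u0 is a cycle modulo B + aV, hence u0 = d u2 + a u3 modulo [B],
   and cancelling [a] leaves a^k u = d u3. *)
elim: k u0 hu0 ku0 {hk'} => [|k IHk] u0 hu0 ku0; first by exists u0; rewrite -[u]scale1r.
have := IH _ i.+1 u0 hB'; case=> //.
- move=> r /nil [j hj]; exists j; apply: igen_mono hj => t [ht|ht]; last by right.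
  by left=> v; apply: BB'.
- by move=> c cw; apply: wm; rewrite inE cw orbT.
- by move: lt => /=; lia.
- have -> : kd u0 = a *: (a ^+ k *: u) - (a ^+ k.+1 *: u - kd u0).
    by rewrite scalerA -exprS subKr.
  have hk2 := kin_submod (size s) hB'.
  apply: submodB => //; last exact: kin_sub ku0.
  by apply: kin_ann => v; apply: sub_saddr => //; exists v.
move=> u2 [hu2 ku2].
have [|u3 [hu3 ku3]] := @kin_split B a _ i.+1 (u0 - kd u2) hB _ ku2.
  by apply: submodB => //; [apply: homog_submod|apply: homog_kd].
apply: (IHk u3) => //; apply: (kin_reg rega).
have := kin_kd hB ku3; rewrite !(linB (kd_linear s)) kdK subr0 dZ => ku3'.
have -> : a *: (a ^+ k *: u - kd u3) = (a ^+ k.+1 *: u - kd u0) + (kd u0 - a *: kd u3).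
  by rewrite addrA subrK scalerBr scalerA -exprS.
exact: submodD.
Qed.

Fixpoint kin0 n (v : V) : kos n :=
  match n with 0 => v | n'.+1 => (kin0 n' v, 0) end.

Lemma kin0_linear n : is_linear (@kin0 n).
Proof.
elim: n => [|n [IH1 IH2]] //=; split=> [u v|r v]; congr pair; rewrite ?IH1 ?IH2 ?addr0 ?scaler0 //.
Qed.

Lemma homog_kin0 n v : homog 0 (kin0 n v).
Proof. by elim: n => [|n IH] //=. Qed.

Lemma kin_kin0 B n v : kin B (kin0 n v) -> B v.
Proof. by elim: n => [|n IH] //= [/IH]. Qed.

Lemma homog0P n (u : kos n) : homog 0 u -> exists v, u = kin0 n v.
Proof.
elim: n u => [|n IH] u /=; first by exists u.
by case: u => u1 u2 /= [/IH [v ->] ->]; exists v.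
Qed.

(** Together with [IM_kd], this identifies the Koszul homology in degree 0 with V/sV. *)
Lemma kd_image s (u : kos (size s)) : homog 1 u -> exists v, IM V s v /\ kd u = kin0 _ v.
Proof.
elim: s u => [|y s IH] u /=.
  by exists 0; split=> //; apply: submod0 (IM_submod _ _).
case: u => u1 u2 /= [/IH [v [hv ->]] h2].
rewrite (homog0_kd h2); have [w ->] := homog0P h2.
exists (v + y *: w); rewrite oppr0; have [hD hZ] := kin0_linear (size s).
split; last by rewrite hD hZ.
apply: submodD; first exact: IM_submod.
  by apply: IM_subset hv => a ag; rewrite inE ag orbT.
by apply: IM_gen; rewrite inE eqxx.
Qed.

Lemma IM_kd s v : IM V s v -> exists u, homog 1 u /\ @kd s u = kin0 _ v.
Proof.
have [hD hZ] := kin0_linear (size s); have [dD dZ] := kd_linear s.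
have hh := homog_submod (size s) 1.
move: v; apply: IM_min.
  split; first by exists 0; rewrite (lin0 (kin0_linear _)) (lin0 (kd_linear s)); split=> //; apply: submod0.
  split=> [u v [u' [hu eu]] [v' [hv ev]]|r v [v' [hv ev]]].
    by exists (u' + v'); split; [apply: submodD|rewrite dD hD eu ev].
  by exists (r *: v'); split; [apply: submodZ|rewrite dZ hZ ev].
move=> a v /kd_homotopy [h [hl ek hd _]]; exists (h (kin0 _ v)); split.
  exact: hd (homog_kin0 _ _).
have := ek (kin0 _ v).
by rewrite (homog0_kd (homog_kin0 _ v)) (lin0 hl) addr0 hZ.
Qed.

End Koszul.

(** * Ideals primary to the maximal ideal *)

Section PrimaryIdeals.
Variables (R : comNzRingType) (m : R -> Prop).

(* [s] generates an m-primary ideal modulo the annihilator of [V]. *)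
Definition mprimary (V : lmodType R) (s : seq R) :=
  forall r, m r -> exists k, igen (fun a => ann V a \/ a \in s) (r ^+ k).

Lemma mprimary_subset (V : lmodType R) s s' : {subset s <= s'} -> mprimary V s -> mprimary V s'.
Proof.
move=> ss' h r /h [k hk]; exists k; apply: igen_mono hk => a [|/ss']; [left|right] => //.
Qed.

(** Write r^k = j + c y with j from the other generators; its n-th power is congruent to (c y)^n
    modulo j. *)
Lemma mprimary_pow (V : lmodType R) s1 y s2 n :
  mprimary V (s1 ++ y :: s2) -> mprimary V (s1 ++ y ^+ n :: s2).
Proof.
move=> h r /h [k hk]; exists (k * n)%N.
pose J := igen (fun a => ann V a \/ a \in s1 ++ s2).
have hJ : is_ideal J by apply: igen_ideal.
rewrite exprM; have [j [c [Jj ->]]] : iadd J y (r ^+ k).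
  apply: hk; first exact: iadd_ideal.
  move=> a [ha|]; first by apply: sub_iadd; apply: igen_mem; left.
  rewrite mem_cat inE => /or3P[h1|/eqP->|h2]; last 1 first.
  - by apply: sub_iadd; apply: igen_mem; right; rewrite mem_cat h2 orbT.
  - by apply: sub_iadd; apply: igen_mem; right; rewrite mem_cat h1.
  - exact: iadd_mem.
pose J' := igen (fun a => ann V a \/ a \in s1 ++ y ^+ n :: s2).
have hJ' : is_ideal J' by apply: igen_ideal.
have JJ' : sub J J'.
  apply: igen_mono => a [|]; [by left|rewrite !mem_cat inE => /orP[->|->]; right] => //.
  by rewrite !orbT.
have yJ' : J' (y ^+ n) by apply: igen_mem; right; rewrite mem_cat inE eqxx orbT.
rewrite -/J' -(subrK ((c * y) ^+ n) ((j + c * y) ^+ n)); apply: (idlD hJ').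
  by rewrite subrXX addrK; apply: (idlMr _ hJ'); apply: JJ'.
by rewrite exprMn; apply: (idlMl _ hJ').
Qed.

Fixpoint mon (y : seq R) (a : seq nat) : R :=
  match y, a with
  | y0 :: y', a0 :: a' => y0 ^+ a0 * mon y' a'
  | _, _ => 1
  end.

(** With exponents shifted by one, [mon y b] lies in the ideal of [powS y a] as soon as [b] is not
    componentwise below [a]. *)
Definition powS (y : seq R) (a : seq nat) : seq R := [seq p.1 ^+ p.2.+1 | p <- zip y a].

Lemma mprimary_powS (V : lmodType R) s y a : size a = size y ->
  mprimary V (s ++ y) -> mprimary V (s ++ powS y a).
Proof.
elim: y s a => [|y0 y IH] s [|a0 a] //= [sa] h.
by rewrite /powS /= -cat_rcons; apply: IH => //; rewrite cat_rcons; apply: mprimary_pow.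
Qed.

Section Regular.
Variables (V : lmodType R) (w : seq R).
Hypotheses (wm : forall a, a \in w -> m a) (regw : regB (@null R V) w).

(** A relation y v = d u makes (-u, v) a Koszul cycle of degree 1 for [y :: s]. Its length equals
    that of [w], so the cycle is a boundary, whose second component puts v in sV. *)
Lemma parameter_regular y s v : size w = (size s).+1 -> mprimary V (y :: s) ->
  IM V s (y *: v) -> IM V s v.
Proof.
move=> sw nil /IM_kd [u [hu eu]].
have hn := @null_submod R V.
pose U : kos V (size (y :: s)) := (- u, kin0 (size s) v).
have hU : homog 1 U.
  split=> /=; last exact: homog_kin0.
  by apply: submodN => //; apply: homog_submod.
have kU : kd U = 0.
  have [kD kZ] := kd_linear V s; have [iD iZ] := kin0_linear V (size s).
  rewrite /= -scaleN1r kZ scaleN1r eu iZ addNr.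
  by rewrite (homog0_kd (homog_kin0 _ _)) oppr0.
have [||||||u' [hu' ku']] := @koszul_exact _ _ m (y :: s) w (@null R V) 1 U hn.
- move=> r /nil [k hk]; exists k; apply: igen_mono hk => a [ha|ha]; last by right.
  by left=> x; apply: ha.
- by [].
- by [].
- by rewrite /= sw.
- by [].
- by rewrite kU; apply: submod0 (kin_submod _ hn).
move: hu' ku' => /= [_ h2] [_ ku'].
have [v' [hv' e']] := kd_image h2.
rewrite e' opprK -(proj1 (kin0_linear V _)) in ku'.
have -> : v = - v' by apply/eqP; rewrite -addr_eq0; apply/eqP; apply: kin_kin0 ku'.
by apply: submodN => //; apply: IM_submod.
Qed.

(** One variable at a time, with the finished ones in [s]: if y0^a0 u - y0^(a0+1) n lies in the
    submodule of the other terms, cancelling the parameter y0^a0 puts u - y0 n there. *)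
Lemma colon_mon y : forall s a v, size a = size y -> size w = size (s ++ y) ->
  mprimary V (s ++ y) -> IM V (s ++ powS y a) (mon y a *: v) -> IM V (s ++ y) v.
Proof.
elim: y => [|y0 y IH] s [|a0 a] v //=; first by rewrite scale1r.
move=> [sa] sw nil.
rewrite -scalerA /powS /= -/(powS y a) => h.
rewrite -cat_rcons; apply: (IH _ a) => //; rewrite cat_rcons //.
move: (mon y a *: v) h => u h {v IH}.
have hx x : IM V (s ++ x :: powS y a) = sadd (IM V (s ++ powS y a)) (simg V x).
  rewrite -IM1 -IM_cat; apply: pred_ext; apply: IM_subset => b;
  by rewrite !(mem_cat, inE) [(b == x) || _]orbC orbA.
move: h; rewrite !hx => -[p [_ [hp [[n ->] e]]]].
exists (u - y0 *: n), (y0 *: n); rewrite subrK; split; last by split=> //; exists n.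
apply: (@parameter_regular (y0 ^+ a0)).
- by move: sw; rewrite !size_cat /= size_map size_zip sa minnn addnS.
- have /= := mprimary_pow (s1 := [::]) a0 (mprimary_subset _ (@mprimary_powS V (rcons s y0) y a sa _)).
  apply; last by rewrite cat_rcons.
  move=> b; rewrite cat_rcons !(mem_cat, inE) => /or3P[->|->|->]; rewrite ?orbT //.
by rewrite scalerBr scalerA -exprSr e addrK.
Qed.

End Regular.

Lemma regular_regB (V : lmodType R) y : regular_seq V m y -> regB (@null R V) y.
Proof.
move=> [_ [hreg _]].
have : forall k i, (i + k = size y)%N -> regB (IM V (take i y)) (drop i y).
  elim=> [|k IH] i e; first by rewrite drop_oversize //; lia.
  have lt : (i < size y)%N by lia.
  rewrite (drop_nth 0 lt) /=; split; first exact: hreg.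
  rewrite -IM1 -IM_cat cats1 -take_nth //; apply: IH; lia.
by move=> /(_ (size y) 0%N erefl); rewrite take0 drop0 IM_nil.
Qed.

Section Powers.
Variables (V : lmodType R) (y : seq R).

Definition Ipow n := IM V (powgens y n).

Lemma Ipow_submod n : is_submod (Ipow n). Proof. exact: IM_submod. Qed.

Lemma Ipow0 : Ipow 0 = @full V.
Proof.
apply: pred_ext => // v _; rewrite -[v]scale1r; apply: IM_gen.
by rewrite /= inE.
Qed.

Lemma Ipow_mul n a v : igen (fun r => ann V r \/ r \in y) a -> Ipow n v -> Ipow n.+1 (a *: v).
Proof.
move=> ha hv; have hi := colon_ideal (Ipow n) (Ipow_submod n.+1).
apply: (igen_min hi _ ha) => // {ha hv v}a [ha v _|ay].
  by rewrite ha; apply: submod0 (Ipow_submod _).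
apply: IM_min; first exact: (colon_submod a (Ipow_submod _)).
move=> b u bp; rewrite /colon scalerA; apply: IM_gen.
by rewrite /=; apply/allpairsP; exists (a, b).
Qed.

Lemma IpowS n : sub (Ipow n.+1) (Ipow n).
Proof.
elim: n => [|n IH]; first by rewrite Ipow0.
apply: IM_min; first exact: Ipow_submod.
move=> _ u /allpairsP [[a b] [/= ay bp ->]]; rewrite -scalerA; apply: Ipow_mul.
  by apply: igen_mem; right.
by apply: IH; apply: IM_gen.
Qed.

Lemma Ipow1 : Ipow 1 = IM V y.
Proof.
have e : powgens y 1 =i y.
  move=> a; apply/allpairsP/idP => [[[b c] [/= by_]]|ay].
    by rewrite inE => /eqP -> ->; rewrite mulr1.
  by exists (a, 1); rewrite /= mulr1 inE.
by apply: pred_ext; apply: IM_subset => a; rewrite e.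
Qed.

Lemma mprimary_Ipow n r : mprimary V y -> m r -> exists k, forall v, Ipow n (r ^+ k *: v).
Proof.
move=> nil /nil [k hk]; exists (k * n)%N; elim: n => [|n IH] v; first by rewrite Ipow0.
by rewrite mulnS exprD -scalerA; apply: Ipow_mul.
Qed.

Lemma finlen_Ipow n (B : V -> Prop) : noetherian_ring R -> local_ring_with m -> noeth V ->
  mprimary V y -> is_submod B -> finlen (sadd (Ipow n) B) (@full V).
Proof.
move=> nR lm nV nil hB; apply: (finlen_of_nil nR lm) => //.
  by apply: sadd_submod => //; apply: Ipow_submod.
move=> r mr v; have [k hk] := mprimary_Ipow n nil mr; exists k.
exact: sub_saddl.
Qed.

End Powers.

Lemma det_congr (J : R -> Prop) n (A B : 'M[R]_n) : is_ideal J ->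
  (forall i j, J (A i j - B i j)) -> J (\det A - \det B).
Proof.
move=> hJ h; rewrite /determinant -sumrB; apply: idl_sum => // s _.
rewrite -mulrBr; apply: idlMl => //.
apply: (big_ind2 (fun a b => J (a - b))) => [|a a' b b' ha hb|i _]; last exact: h.
  by rewrite subrr; apply: idl0.
have -> : a * b - a' * b' = a * (b - b') + (a - a') * b' by ring.
by apply: idlD => //; [apply: idlMl|apply: idlMr].
Qed.

Lemma det_kills (V : lmodType R) n (B : 'M[R]_n) (e : 'I_n -> V) k :
  \det B *: e k = \sum_i (\adj B) k i *: \sum_j B i j *: e j.
Proof.
transitivity (\sum_j (\det B)%:M k j *: e j).
  rewrite (bigD1 k) //= mxE eqxx mulr1n big1 ?addr0 // => j ne.
  by rewrite mxE eq_sym (negPf ne) mulr0n scale0r.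
rewrite -mul_adj_mx.
under eq_bigr do rewrite mxE scaler_suml.
rewrite exchange_big /=; apply: eq_bigr => i _; rewrite scaler_sumr.
by apply: eq_bigr => j _; rewrite scalerA.
Qed.

(** Finite length stops the chain r^k V + xV, so Nakayama gives r^k V inside xV; the determinant
    trick turns this into a statement about [r] modulo Ann V and (x). *)
Lemma mprimary_of_finlen (V : lmodType R) x : noetherian_ring R -> local_ring_with m ->
  fin_gen V -> finlen (IM V x) (@full V) -> mprimary V x.
Proof.
move=> nR lm fg [N /is_lengthP [_ hN]] r mr; have nV := fg_noeth nR fg.
have hx := IM_submod V x.
pose D k := sadd (simg V (r ^+ k)) (IM V x).
have hD k : is_submod (D k) by apply: sadd_submod => //; apply: simg_submod.
have Dd k : sub (D k.+1) (D k).
  apply: sadd_sub => //; last by apply: sub_saddr; apply: simg_submod.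
  move=> v [u ->]; apply: sub_saddl => //; exists (r *: u).
  by rewrite scalerA -exprSr.
have [k hk] : exists k, sub (D k) (D k.+1).
  apply: NNPP => hn; have ch n : pchain (D n) (D 0%N) n.
    elim: n => [|n IH]; first exact: pchain0.
    rewrite -add1n; apply: pchain_cat IH; apply: pchainS (Dd n) _ => //; first exact: pchain0.
    by move=> h; apply: hn; exists n.
  have [|j hj] := @pchain_exists _ _ (IM V x) (D N.+1) hx (hD _).
    by apply: sub_saddr; apply: simg_submod.
  have e0 : D 0%N = @full V.
    by apply: pred_ext => // v _; apply: sub_saddl => //; exists v; rewrite scale1r.
  by have := hN _ (pchain_cat hj (eq_ind _ (fun A => pchain (D N.+1) A N.+1) (ch N.+1) _ e0)); lia.
have hTx : sub (simg V (r ^+ k)) (IM V x).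
  apply: (nakayama nR lm nV (r := r)) => //; first exact: simg_submod.
  move=> p [u ->].
  have /hk [_ [q [[u' ->] [hq ->]]]] : D k (r ^+ k *: u) by apply: sub_saddl => //; exists u.
  by exists (r ^+ k *: u'), q; rewrite scalerA -exprS; do !split=> //; exists u'.
have [s hs] := fg.
pose J := igen (fun a => a \in x); have hJ : is_ideal J by apply: igen_ideal.
have co v : IM V x v -> exists c : 'I_(size s) -> R, (forall j, J (c j)) /\ v = \sum_j c j *: s`_j.
  move: v; apply: IM_min.
    split; first by exists (fun _ => 0); split=> [j|]; [apply: (idl0 hJ)|rewrite big1 // => j _; rewrite scale0r].
    split=> [u v [c [hc ->]] [e [he ->]]|t v [c [hc ->]]].
      exists (fun j => c j + e j); split=> [j|]; first exact: (idlD hJ).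
      by rewrite -big_split; apply: eq_bigr => j _; rewrite scalerDl.
    exists (fun j => t * c j); split=> [j|]; first exact: (idlMl _ hJ).
    by rewrite scaler_sumr; apply: eq_bigr => j _; rewrite scalerA.
  move=> a u ax; have [rs [_ ->]] := hs u; exists (fun j => a * rs`_j).
  split=> [j|]; first by apply: (idlMr _ hJ); apply: igen_mem.
  by rewrite scaler_sumr; apply: eq_bigr => j _; rewrite scalerA.
have /fin_all_exists [A hA] : forall i : 'I_(size s), exists c : 'I_(size s) -> R,
    (forall j, J (c j)) /\ r ^+ k *: s`_i = \sum_j c j *: s`_j.
  by move=> i; apply: co; apply: hTx; exists s`_i.
(* This matrix kills the vector of generators, so its determinant annihilates V; modulo (x) that
   determinant is r^(k * size s). *)
pose B : 'M[R]_(size s) := (r ^+ k)%:M - \matrix_(i, j) A i j.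
have Bann : ann V (\det B).
  move=> v; have [rs [_ ->]] := hs v; rewrite scaler_sumr big1 // => i _.
  rewrite scalerA mulrC -scalerA (det_kills B (fun j : 'I_(size s) => s`_j)).
  rewrite big1 ?scaler0 // => l _; suff -> : \sum_j B l j *: s`_j = 0 by rewrite scaler0.
  under eq_bigr do rewrite !mxE scalerBl.
  rewrite sumrB -(proj2 (hA l)) (bigD1 l) //= eqxx mulr1n big1 ?addr0 ?subrr // => j ne.
  by rewrite eq_sym (negPf ne) mulr0n scale0r.
exists (k * size s)%N; rewrite exprM -det_scalar -(subrK (\det B) (\det _)).
apply: (idlD (igen_ideal _)); last by apply: igen_mem; left.
apply: (@igen_mono _ (fun a => a \in x)); first by move=> a; right.
apply: (det_congr hJ) => i j; rewrite !mxE opprB addrC subrK.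
exact: (proj1 (hA i)).
Qed.

End PrimaryIdeals.

Arguments Ipow {R} V y n _.

(** * Eventually polynomial functions *)

(* [f] is eventually a polynomial of degree at most [d] whose coefficient in degree [d] is [c / d!], phrased through the [d]-th finite difference. *)
Fixpoint polylike (d : nat) (c : int) (f : nat -> int) : Prop :=
  if d is d'.+1 then exists g, polylike d' c g /\ exists n0, forall n, (n0 <= n)%N -> f n.+1 - f n = g n
  else exists n0, forall n, (n0 <= n)%N -> f n = c.

Lemma polylike_ext d c f f' n0 : (forall n, (n0 <= n)%N -> f n = f' n) ->
  polylike d c f -> polylike d c f'.
Proof.
case: d => [|d] /= e [].
  by move=> n1 h; exists (maxn n0 n1) => n le; rewrite -e ?h //; lia.
move=> g [hg [n1 h]]; exists g; split=> //; exists (maxn n0 n1) => n le.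
by rewrite -!e ?h //; lia.
Qed.

Lemma polylikeD d c c' f f' : polylike d c f -> polylike d c' f' ->
  polylike d (c + c') (fun n => f n + f' n).
Proof.
elim: d f f' => [|d IH] f f' /=.
  by move=> [n1 h1] [n2 h2]; exists (maxn n1 n2) => n le; rewrite h1 ?h2 //; lia.
move=> [g [hg [n1 h1]]] [g' [hg' [n2 h2]]].
exists (fun n => g n + g' n); split; first exact: IH.
exists (maxn n1 n2) => n le; rewrite -h1 -?h2; [ring|lia|lia].
Qed.

Lemma polylikeN d c f : polylike d c f -> polylike d (- c) (fun n => - f n).
Proof.
elim: d f => [|d IH] f /=; first by move=> [n1 h1]; exists n1 => n le; rewrite h1.
move=> [g [hg [n1 h1]]]; exists (fun n => - g n); split; first exact: IH.
by exists n1 => n le; rewrite -h1 //; ring.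
Qed.

Lemma polylike_shift d c f j : polylike d c f -> polylike d c (fun n => f (n - j)%N).
Proof.
elim: d f => [|d IH] f /=.
  by move=> [n1 h1]; exists (n1 + j)%N => n le; rewrite h1 //; lia.
move=> [g [hg [n1 h1]]]; exists (fun n => g (n - j)%N); split; first exact: IH.
exists (n1 + j)%N => n le; rewrite -h1; last by lia.
by rewrite subSn //; lia.
Qed.

Lemma polylike_shiftS d c f : polylike d c f -> polylike d c (fun n => f n.+1).
Proof.
elim: d f => [|d IH] f /=; first by move=> [n1 h1]; exists n1 => n le; rewrite h1 ?leqW.
move=> [g [hg [n1 h1]]]; exists (fun n => g n.+1); split; first exact: IH.
by exists n1 => n le; rewrite -h1 ?leqW.
Qed.

(** Lower-order terms are padded to the top degree with coefficient 0, and so drop out of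
    comparisons of leading coefficients. *)
Lemma polylike_lift d c f : polylike d c f -> polylike d.+1 0 f.
Proof.
elim: d f => [|d IH] f.
  move=> [n1 h1]; exists (fun _ => 0); split; first by exists 0%N.
  by exists n1 => n le; rewrite !h1 ?subrr //; lia.
by move=> [g [hg h]]; exists g; split=> //; apply: IH.
Qed.

Lemma polylike0_const d : polylike d 0 (fun _ => 0).
Proof.
by elim: d => [|d IH] /=; [exists 0%N|exists (fun _ => 0); split=> //; exists 0%N].
Qed.

Lemma polylike_neg d (c : int) f : c < 0 -> polylike d c f ->
  exists n0, forall n, (n0 <= n)%N -> f n <= -1.
Proof.
move=> c0; elim: d f => [|d IH] f /=; first by move=> [n0 h]; exists n0 => n /h ->; lia.
move=> [g [/IH [n1 h1] [n2 h2]]]; pose k := maxn n1 n2.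
have step j : f (k + j)%N <= f k - j%:Z.
  elim: j => [|j IHj]; first by rewrite addn0 subr0.
  have := h2 (k + j)%N; rewrite addnS; have := h1 (k + j)%N.
  by rewrite /k in IHj *; lia.
exists (k + `|f k|%N.+1)%N => n le; have := step (n - k)%N.
by rewrite subnKC; lia.
Qed.

(** Turns an inequality between Hilbert functions into one between multiplicities. *)
Lemma polylike_ge0 d (c : int) f n0 : polylike d c f ->
  (forall n, (n0 <= n)%N -> 0 <= f n) -> 0 <= c.
Proof.
move=> hf f0; rewrite leNgt; apply/negP => /polylike_neg /(_ hf) [n1 h1].
by have := f0 (maxn n0 n1) (leq_maxl _ _); have := h1 (maxn n0 n1) (leq_maxr _ _); lia.
Qed.

(** On this basis the forward difference acts as differentiation does on powers. *)
Fixpoint falling (d : nat) : {poly rat} :=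
  if d is d'.+1 then falling d' * ('X - d'%:R%:P) else 1.

Lemma falling_monic d : falling d \is monic.
Proof. by elim: d => [|d IH] /=; [apply: monic1|rewrite monicMl ?monicXsubC]. Qed.

Lemma size_falling d : size (falling d) = d.+1.
Proof.
elim: d => [|d IH] /=; first by rewrite size_poly1.
by rewrite size_Mmonic ?monicXsubC ?monic_neq0 ?falling_monic // IH size_XsubC addn2.
Qed.

Lemma falling_diff d x : (falling d.+1).[x + 1] - (falling d.+1).[x] = d.+1%:R * (falling d).[x].
Proof.
have hS k y : (falling k.+1).[y] = (falling k).[y] * (y - k%:R) by rewrite /= hornerM hornerXsubC.
have e k : (falling k.+1).[x + 1] = (x + 1) * (falling k).[x].
  elim: k => [|k IH]; first by rewrite hS /= !hornerC subr0 mul1r mulr1.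
  by rewrite hS IH hS -natr1; ring.
by rewrite e hS -natr1; ring.
Qed.

(** The leading term of [Q] is cancelled by a multiple of a falling factorial, whose antidifference
    is known; the remainder has smaller size. *)
Lemma poly_antidiff d (Q : {poly rat}) : (size Q <= d)%N ->
  exists T : {poly rat}, (size T <= d.+1)%N /\ T`_d = Q`_d.-1 / d%:R /\
    forall x : rat, T.[x + 1] - T.[x] = Q.[x].
Proof.
elim: d Q => [|d IH] Q sQ.
  exists 0; rewrite size_poly0 coef0 invr0 mulr0; split=> //; split=> // x.
  by move: sQ; rewrite leqn0 size_poly_eq0 => /eqP ->; rewrite !horner0 subrr.
have lead k : (falling k)`_k = 1.
  by have := falling_monic k; rewrite monicE lead_coefE size_falling => /eqP.
have [|T [sT [_ hT]]] := IH (Q - Q`_d *: falling d).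
  apply/leq_sizeP => j; rewrite leq_eqVlt coefB coefZ => /orP[/eqP <-|lt].
    by rewrite lead mulr1 subrr.
  rewrite (nth_default _ (leq_trans sQ lt)).
  by rewrite [(falling d)`__]nth_default ?mulr0 ?subrr ?size_falling.
exists ((Q`_d / d.+1%:R) *: falling d.+1 + T); split.
  rewrite (leq_trans (size_polyD _ _)) // geq_max (leq_trans (size_scale_leq _ _)) ?size_falling //.
  exact: leqW.
split; first by rewrite coefD coefZ lead mulr1 [T`__]nth_default ?addr0.
move=> x; have := hT x; rewrite !hornerD !hornerN !hornerZ => {}hT.
rewrite opprD addrACA hT -mulrBr falling_diff mulrA divfK ?pnatr_eq0 //; ring.
Qed.

(** An antidifference of the polynomial of [g], corrected by a constant at one point [k], agrees
    with [f] from there on. The successive divisions of the top coefficient accumulate to d!. *)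
Lemma polylike_poly d c f : polylike d c f ->
  exists P : {poly rat}, (size P <= d.+1)%N /\ P`_d = c%:~R / (d`!)%:R /\
    exists n0, forall n, (n0 <= n)%N -> (f n)%:~R = P.[n%:R].
Proof.
elim: d f => [|d IH] f.
  move=> [n0 h]; exists (c%:~R%:P); rewrite size_polyC coefC /= divr1.
  split; first by case: eqP.
  by split=> //; exists n0 => n /h ->; rewrite hornerC.
move=> [g [/IH [Q [sQ [lQ [n1 h1]]]] [n2 h2]]].
have [T [sT [lT hT]]] := poly_antidiff sQ.
pose k := maxn n1 n2; exists (T + ((f k)%:~R - T.[k%:R])%:P); split.
  rewrite (leq_trans (size_polyD _ _)) // geq_max sT size_polyC.
  by case: (_ == 0).
split.
  rewrite coefD coefC /= addr0 lT lQ factS natrM invfM mulrA -!mulrA; congr (_ * _).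
  by rewrite mulrC.
exists k => n le; rewrite hornerD hornerC -(subnKC le).
elim: (n - k)%N => [|j IHj]; first by rewrite addn0 addrC subrK.
have e := h2 (k + j)%N (leq_trans (leq_maxr _ _) (leq_addr _ _)).
have e1 := h1 (k + j)%N (leq_trans (leq_maxl _ _) (leq_addr _ _)).
have := hT (k + j)%:R; rewrite -e1 -e intrB IHj natr1 -addnS => h.
have -> : T.[(k + j.+1)%:R] = T.[(k + j)%:R] + ((f (k + j.+1)%N)%:~R - (T.[(k + j)%:R] + ((f k)%:~R - T.[k%:R]))).
  by rewrite -h; ring.
ring.
Qed.

(** * Sums of antitone functions of exponent vectors *)

Definition antitone d (phi : seq nat -> nat) := forall a b,
  size a = d -> size b = d -> all2 leq a b -> (phi b <= phi a)%N.

Lemma all2_leq_refl a : all2 leq a a.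
Proof. by elim: a => //= x a ->; rewrite leqnn. Qed.

Lemma nonincr_stab (f : nat -> nat) : (forall j, f j.+1 <= f j)%N ->
  exists j0, forall j, (j0 <= j)%N -> f j = f j0.
Proof.
move=> h; have mono i j : (i <= j)%N -> (f j <= f i)%N.
  by move=> /subnK <-; elim: (j - i)%N => // k; apply: leq_trans; apply: h.
have [n [[i ->] hn]] : exists n, (exists i, n = f i) /\ forall j, (n <= f j)%N.
  suff : forall k, (exists i, f i <= k)%N -> exists n, (exists i, n = f i) /\ forall j, (n <= f j)%N.
    by move=> /(_ (f 0%N)); apply; exists 0%N.
  elim=> [|k IH] [i hi].
    by exists 0%N; split=> //; exists i; lia.
  have [hk|nk] := classic (exists i, f i <= k)%N; first exact: IH.
  exists (f i); split; first by exists i.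
  move=> j; rewrite leqNgt; apply/negP => lt; apply: nk; exists j; lia.
by exists i => j /mono; have := hn j; lia.
Qed.

(* Dickson's lemma in disguise; the inductive step compares with the diagonal family [psi j (j :: _)]. *)
Lemma antitone_stab d (psi : nat -> seq nat -> nat) :
  (forall j, antitone d (psi j)) -> (forall j a, size a = d -> psi j.+1 a <= psi j a)%N ->
  exists j0, forall j a, (j0 <= j)%N -> size a = d -> psi j a = psi j0 a.
Proof.
elim: d psi => [|d IH] psi ha hj.
  have [|j0 h] := @nonincr_stab (fun j => psi j [::]); first by move=> j; apply: hj.
  by exists j0 => j a /h ? /size0nil ->.
have mono i j a : (i <= j)%N -> size a = d.+1 -> (psi j a <= psi i a)%N.
  move=> /subnK <- sa; elim: (j - i)%N => // k; apply: leq_trans; exact: hj.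
have refl := all2_leq_refl.
have [||j0 h0] := IH (fun j a => psi j (j :: a)).
- by move=> j a b sa sb ab; apply: ha; rewrite /= ?sa ?sb ?leqnn.
- move=> j a sa; apply: leq_trans (hj _ _ _) _; first by rewrite /= sa.
  by apply: ha; rewrite /= ?sa // leqnSn refl.
(* The value is squeezed between psi j0 (j0 :: a) and a value on the diagonal at max(j, l), which
   are equal. *)
have big l j a : (j0 <= l)%N -> (j0 <= j)%N -> size a = d -> psi j (l :: a) = psi j0 (j0 :: a).
  move=> hl hj' sa; apply/eqP; rewrite eqn_leq; apply/andP; split.
    apply: leq_trans (mono _ _ _ hj' _) _; first by rewrite /= sa.
    by apply: ha; rewrite /= ?sa // hl refl.
  rewrite -(h0 (maxn j l)) //; last by rewrite (leq_trans hl) ?leq_maxr.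
  apply: leq_trans (mono _ _ _ (leq_maxl j l) _) _; first by rewrite /= sa.
  by apply: ha; rewrite /= ?sa // leq_maxr refl.
(* Only finitely many first exponents [l < j0] remain, and each slice stabilizes by induction. *)
have [J hJ] : exists J, forall l, (l < j0)%N -> forall j a, (J <= j)%N -> size a = d ->
    psi j (l :: a) = psi J (l :: a).
  elim: j0 {h0 big} => [|l [J hJ]]; first by exists 0%N.
  have [||K hK] := IH (fun j a => psi j (l :: a)).
  - by move=> j a b sa sb ab; apply: ha; rewrite /= ?sa ?sb ?leqnn.
  - by move=> j a sa; apply: hj; rewrite /= sa.
  exists (maxn J K) => i lt j a le sa; have [eq|ne] := eqVneq i l.
    by rewrite eq !(hK _ a) //; lia.
  by rewrite !(hJ i _ _ a) //; lia.
exists (maxn j0 J) => j [|l a] le //= [sa].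
have [lt|ge] := ltnP l j0; first by rewrite !(hJ l lt _ a) //; lia.
by rewrite !big //; lia.
Qed.

(* Sum of [phi] over the exponent vectors of length [d] and degree [n]. *)
Fixpoint degsum d (phi : seq nat -> nat) (n : nat) : nat :=
  if d is d'.+1 then \sum_(0 <= j < n.+1) degsum d' (fun a => phi (j :: a)) (n - j)
  else if n is 0 then phi [::] else 0.

Definition cumsum d phi n : nat := \sum_(0 <= k < n) degsum d phi k.

Lemma degsum_ext d phi psi n : (forall a, size a = d -> sumn a = n -> phi a = psi a) ->
  degsum d phi n = degsum d psi n.
Proof.
elim: d phi psi n => [|d IH] phi psi n h /=; first by case: n h => // h; apply: h.
apply: eq_big_nat => j /andP[_ le]; apply: IH => a sa na; apply: h => /=; first by rewrite sa.
by rewrite na; lia.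
Qed.

Lemma cumsumS d phi n :
  cumsum d.+1 phi n = \sum_(0 <= j < n) cumsum d (fun a => phi (j :: a)) (n - j).
Proof.
elim: n => [|n IH]; first by rewrite /cumsum !big_nil.
rewrite /cumsum big_nat_recr //= -/(cumsum d.+1 phi n) IH.
rewrite [in RHS]big_nat_recr //= subSnn [\sum_(0 <= k < 1) _]big_nat1.
rewrite [in LHS]big_nat_recr //= subnn addnA; congr (_ + _)%N.
rewrite -big_split /=; apply: eq_big_nat => j /andP[_ lt].
by rewrite /cumsum subSn ?(ltnW lt) // [in RHS]big_nat_recr.
Qed.

(** Slices with first exponent at least [j0] are all equal, and summing them raises the degree by
    one with the same leading coefficient; the finitely many earlier slices have lower degree. *)
Lemma cumsum_polylike d phi : antitone d phi ->
  exists a, size a = d /\ polylike d (phi a)%:Z (fun n => (cumsum d phi n)%:Z).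
Proof.
elim: d phi => [|d IH] phi ha.
  exists [::]; split=> //; exists 1%N => -[//|n] _.
  rewrite /cumsum big_nat_recl //= big1 ?addn0 // => i _.
have hac j : antitone d (fun a => phi (j :: a)).
  by move=> a b sa sb ab; apply: ha; rewrite /= ?sa ?sb ?leqnn.
have refl := all2_leq_refl.
have [|j0 h0] := @antitone_stab d (fun j a => phi (j :: a)) hac.
  by move=> j a sa; apply: ha; rewrite /= ?sa // leqnSn refl.
have [a [sa hp]] := IH _ (hac j0).
exists (j0 :: a); split; first by rewrite /= sa.
pose F j n := (cumsum d (fun a => phi (j :: a)) n)%:Z.
pose G n := \sum_(j0 <= j < n) F j0 (n - j)%N.
have hG : polylike d.+1 (phi (j0 :: a))%:Z G.
  exists (fun n => F j0 (n.+1 - j0)%N); split.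
    have := polylike_shift j0 (polylike_shiftS hp).
    by apply: (polylike_ext (n0 := j0)) => n le; rewrite /F subSn.
  exists j0 => n le; rewrite /G big_nat_recl //.
  by under eq_bigr do rewrite subSS; rewrite addrK.
have hH k : polylike d.+1 0 (fun n => \sum_(0 <= j < k) F j (n - j)%N).
  elim: k => [|k IHk].
    apply: (polylike_ext (n0 := 0%N)) (polylike0_const d.+1) => n _.
    by rewrite big_nil.
  have [b [_ hb]] := IH _ (hac k).
  have := polylikeD IHk (polylike_lift (polylike_shift k hb)); rewrite addr0.
  by apply: (polylike_ext (n0 := 0%N)) => n _; rewrite big_nat_recr.
have := polylikeD hG (hH j0); rewrite addr0; apply: (polylike_ext (n0 := j0)) => n le.
pose u j := cumsum d (fun a => phi (j :: a)) (n - j).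
have -> : cumsum d.+1 phi n = (\sum_(0 <= j < j0) u j + \sum_(j0 <= j < n) u j)%N.
  by rewrite cumsumS (@big_cat_nat _ _ _ j0).
rewrite PoszD addrC /u; congr (_ + _).
  by rewrite (big_morph Posz PoszD (erefl _)).
rewrite (big_morph Posz PoszD (erefl _)); apply: eq_big_nat => j /andP[lj _].
rewrite /F /cumsum; congr Posz; apply: eq_bigr => k _.
by apply: degsum_ext => b sb _; rewrite (h0 j).
Qed.

(** * Hilbert-Samuel functions *)

Fixpoint lexlt (a b : seq nat) : bool :=
  match a, b with
  | i :: a', j :: b' => (i < j)%N || ((i == j) && lexlt a' b')
  | _, _ => false
  end.

Definition padd (a b : seq nat) : seq nat := [seq (p.1 + p.2)%N | p <- zip a b].

Lemma size_padd a b : size a = size b -> size (padd a b) = size a.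
Proof. by move=> e; rewrite size_map size_zip e minnn. Qed.

Lemma sumn_padd a b : size a = size b -> sumn (padd a b) = (sumn a + sumn b)%N.
Proof. by elim: a b => [|i a IH] [|j b] //= [/IH e]; rewrite /padd /= -/(padd a b) e addnACA. Qed.

Lemma lexlt_padd a b e : size a = size e -> size b = size e ->
  lexlt (padd a e) (padd b e) = lexlt a b.
Proof.
elim: e a b => [|k e IH] [|i a] [|j b] //= [sa] [sb].
by rewrite /padd /= -/(padd a e) -/(padd b e) IH // ltn_add2r eqn_add2r.
Qed.

Lemma all2_leq_padd a b : all2 leq a b -> exists e, size e = size a /\ b = padd a e.
Proof.
elim: a b => [|i a IH] [|j b] //=; first by exists [::].
move=> /andP[ij /IH [e [se eb]]]; exists ((j - i)%N :: e); split; first by rewrite /= se.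
by rewrite /padd /= -/(padd a e) -eb subnKC.
Qed.

Lemma all2_leq_sumn a b : all2 leq b a -> (sumn b <= sumn a)%N /\ (sumn b = sumn a -> b = a).
Proof.
elim: b a => [|j b IH] [|i a] //= /andP[ji /IH [le h]]; split; first by lia.
move=> e; have ej : j = i by lia.
by rewrite ej h //; move: e; rewrite ej => /addnI.
Qed.

Lemma lexlt_irr a : lexlt a a = false.
Proof. by elim: a => //= i a ->; rewrite ltnn eqxx. Qed.

Section Generated.
Variables (R : comNzRingType) (V : lmodType R).

Definition gsp (B : V -> Prop) (X : R -> Prop) : V -> Prop := fun v =>
  forall S, is_submod S -> sub B S -> (forall x u, X x -> S (x *: u)) -> S v.

Lemma gsp_submod B X : is_submod (gsp B X).
Proof.
split; first by move=> S hS *; apply: submod0.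
split=> [u v hu hv S hS BS XS|r v hv S hS BS XS]; last by apply: submodZ => //; apply: hv.
by apply: submodD => //; [apply: hu|apply: hv].
Qed.
Lemma gsp_base B X : sub B (gsp B X).
Proof. by move=> v Bv S _ BS _; apply: BS. Qed.
Lemma gsp_gen B (X : R -> Prop) x u : X x -> gsp B X (x *: u).
Proof. by move=> Xx S _ _; apply. Qed.
Lemma gsp_min B (X : R -> Prop) S : is_submod S -> sub B S ->
  (forall x u, X x -> S (x *: u)) -> sub (gsp B X) S.
Proof. by move=> hS BS XS v; apply. Qed.

(** Multiplication by [c] induces an isomorphism from V/(B : c) onto (B + cV)/B. *)
Lemma colon_qlen B c : is_submod B -> qlen B (sadd B (simg V c)) = ell (colon B c).
Proof.
move=> hB; symmetry; have hl : is_linear (fun v : V => c *: v).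
  by split=> [u v|r v]; [rewrite scalerDr|rewrite !scalerA mulrC].
apply: (iso_qlen hl) => //.
- exact: colon_submod.
- by apply: sadd_submod => //; apply: simg_submod.
- by apply: sub_saddl; apply: simg_submod.
- by move=> v _; apply: sub_saddr => //; exists v.
- move=> w [b [_ [Bb [[u ->] ->]]]]; exists u; split=> //.
  by rewrite addrK.
Qed.

Definition monset (c : R) (y : seq R) (n : nat) (P : seq nat -> bool) : R -> Prop :=
  fun x => exists b, [/\ size b = size y, sumn b = n, P b & x = c * mon y b].

(** The monomials are added in lexicographic order. Fixing the first exponent [k] leaves one
    variable fewer, with y0^k absorbed into [c] and the smaller exponents into the base [G k];
    without variables a single step of length l(V/(B : c)) remains. *)
Lemma monomial_filtration (y : seq R) : forall c B n, is_submod B -> finlen B (@full V) ->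
  qlen B (gsp B (monset c y n predT)) =
  degsum (size y) (fun a => ell (colon (gsp B (monset c y n (lexlt^~ a))) (c * mon y a))) n.
Proof.
elim: y => [|y0 y IH] c B n hB fB.
  case: n => [|n] /=; last first.
    have -> : gsp B (monset c [::] n.+1 predT) = B; last exact: qlenxx.
    apply: pred_ext; last exact: gsp_base.
    by apply: gsp_min => // x u [[|? ?] []].
  have -> : gsp B (monset c [::] 0 (lexlt^~ [::])) = B.
    apply: pred_ext; last exact: gsp_base.
    by apply: gsp_min => // x u [[|? ?] []].
  rewrite mulr1 -colon_qlen //; congr qlen.
  have hs : is_submod (sadd B (simg V c)) by apply: sadd_submod => //; apply: simg_submod.
  apply: pred_ext.
    apply: gsp_min => //; first by apply: sub_saddl; apply: simg_submod.
    move=> x u [[|? ?] [//= _ _ _ ->]]; rewrite mulr1; apply: sub_saddr => //; by exists u.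
  apply: sadd_sub; [exact: gsp_submod|exact: gsp_base|].
  by move=> v [u ->]; apply: gsp_gen; exists [::]; rewrite mulr1.
pose G k := gsp B (monset c (y0 :: y) n (fun b => head 0%N b < k)%N).
have hG k : is_submod (G k) by apply: gsp_submod.
have G0 : G 0%N = B.
  by apply: pred_ext; [apply: gsp_min => // x u [b []]|apply: gsp_base].
have Gend : gsp B (monset c (y0 :: y) n predT) = G n.+1.
  apply: pred_ext; apply: gsp_min; try exact: gsp_submod; try exact: gsp_base.
    move=> x u [[|i b] [sb nb _ ->]] //; apply: gsp_gen; exists (i :: b); split=> //=.
    by rewrite ltnS -nb leq_addr.
  by move=> x u [b [? ? _ ->]]; apply: gsp_gen; exists b.
have Gasc k : sub (G k) (G k.+1).
  apply: gsp_min; [exact: gsp_submod|exact: gsp_base|].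
  by move=> x u [b [? ? lt ->]]; apply: gsp_gen; exists b; split=> //; apply: leqW.
have BG k : sub B (G k) by apply: gsp_base.
have fG k : finlen (G k) (@full V) by have [] := finlen_sub (hG k) (BG k) (fun v _ => I) fB.
have Gstep k : (k <= n)%N -> gsp (G k) (monset (c * y0 ^+ k) y (n - k) predT) = G k.+1.
  move=> le; apply: pred_ext.
    apply: gsp_min => // x u [b [sb nb _ ->]]; apply: gsp_gen; exists (k :: b).
    by split=> //=; rewrite ?sb ?nb ?subnKC // mulrA.
  apply: gsp_min; [exact: gsp_submod|by move=> v Bv; apply: gsp_base; apply: BG|].
  move=> x u [[|i b] [//= [sb] nb lt ->]]; have [ik|ik] := ltnP i k.
    by apply: gsp_base; apply: gsp_gen; exists (i :: b); rewrite /= sb.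
  have e : i = k by lia.
  by apply: gsp_gen; exists b; split=> //; [lia|rewrite mulrA e].
have Glt k a : (k <= n)%N -> gsp (G k) (monset (c * y0 ^+ k) y (n - k) (lexlt^~ a)) =
    gsp B (monset c (y0 :: y) n (lexlt^~ (k :: a))).
  move=> le; apply: pred_ext.
    apply: gsp_min; first exact: gsp_submod.
      apply: gsp_min; [exact: gsp_submod|exact: gsp_base|].
      move=> x u [[|i b] [//= [sb] nb lt ->]]; apply: gsp_gen; exists (i :: b).
      by rewrite /= sb lt.
    move=> x u [b [sb nb lt ->]]; apply: gsp_gen; exists (k :: b).
    by split=> /=; rewrite ?sb ?nb ?subnKC // ?mulrA // eqxx lt orbT.
  apply: gsp_min; [exact: gsp_submod|by move=> v Bv; apply: gsp_base; apply: BG|].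
  move=> x u [[|i b] [//= [sb] nb /orP[lt|/andP[/eqP e lt]] ->]].
    by apply: gsp_base; apply: gsp_gen; exists (i :: b); rewrite /= sb.
  by apply: gsp_gen; exists b; split=> //; [lia|rewrite mulrA e].
rewrite Gend /=.
suff key k : (k <= n.+1)%N -> qlen B (G k) = \sum_(0 <= j < k) degsum (size y)
    (fun a => ell (colon (gsp B (monset c (y0 :: y) n (lexlt^~ (j :: a)))) (c * mon (y0 :: y) (j :: a)))) (n - j).
  exact: key.
elim: k => [_|k IHk le]; first by rewrite G0 big_nil qlenxx.
have le' : (k <= n)%N by [].
rewrite big_nat_recr //= -IHk ?leqW //.
have [fBG _] := finlen_sub (hG k.+1) (BG k.+1) (fun v _ => I) fB.
rewrite (qlen_add (hG k) (BG k) (Gasc k) fBG); congr (_ + _)%N.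
rewrite -Gstep // IH //; apply: degsum_ext => a sa na.
by rewrite Glt // mulrA.
Qed.

End Generated.

Section HilbertSamuel.
Variables (R : comNzRingType) (m : R -> Prop) (V : lmodType R) (y : seq R).
Hypotheses (nR : noetherian_ring R) (lm : local_ring_with m) (nV : noeth V) (ny : mprimary m V y).

Local Notation Ipow := (Ipow V y).

Lemma monD (s : seq R) a b : size a = size s -> size b = size s ->
  mon s (padd a b) = mon s a * mon s b.
Proof.
elim: s a b => [|x s IH] [|i a] [|j b] //=; first by rewrite mulr1.
by move=> [sa] [sb]; rewrite /padd /= -/(padd a b) IH // exprD mulrACA.
Qed.

Lemma mon_Ipow n e v : size e = size y -> Ipow n v -> Ipow (n + sumn e) (mon y e *: v).
Proof.
suff : forall s, {subset s <= y} -> forall e n v, size e = size s ->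
    Ipow n v -> Ipow (n + sumn e) (mon s e *: v).
  by move=> h; apply: (h y).
elim=> [|x s IH] sy [|i {}e] {}n {}v //=; first by rewrite addn0 scale1r.
move=> [se] hv; rewrite -scalerA.
have {}hv : Ipow (n + sumn e) (mon s e *: v).
  by apply: IH => // z zs; apply: sy; rewrite inE zs orbT.
rewrite addnCA; elim: i => [|i IHi]; first by rewrite scale1r.
rewrite addSn exprS -scalerA; apply: Ipow_mul => //.
by apply: igen_mem; right; apply: sy; rewrite inE eqxx.
Qed.

Lemma powgens_mon n x : x \in powgens y n ->
  exists b, [/\ size b = size y, sumn b = n & x = mon y b].
Proof.
have unit z : z \in y -> exists e, [/\ size e = size y, sumn e = 1%N & z = mon y e].
  elim: (y) => [//|t s IH]; rewrite inE => /orP[/eqP->|/IH [e [se ne ->]]]; last first.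
    by exists (0%N :: e); rewrite /= se ne mul1r.
  exists (1%N :: nseq (size s) 0%N); rewrite /= size_nseq; split=> //.
    by rewrite sumn_nseq.
  by elim: (s) => [|t' s' IHs] /=; rewrite ?mulr1 // mul1r.
elim: n x => [|n IH] x.
  rewrite /= inE => /eqP ->; exists (nseq (size y) 0%N); rewrite size_nseq sumn_nseq mul0n.
  by split=> //; elim: (y) => //= t s <-; rewrite mulr1.
move=> /allpairsP [[z t] [/= /unit [e [se ne ->]] /IH [b [sb nb ->]] ->]].
exists (padd e b); rewrite size_padd ?se ?sb // sumn_padd ?se ?sb // ne nb monD //.
Qed.

Lemma Ipow_gsp n : Ipow n = gsp (Ipow n.+1) (monset 1 y n predT).
Proof.
apply: pred_ext.
  apply: IM_min; first exact: gsp_submod.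
  move=> x u /powgens_mon [b [sb nb ->]]; apply: gsp_gen; exists b.
  by rewrite mul1r.
apply: gsp_min; [exact: Ipow_submod|exact: IpowS|].
move=> x u [b [sb nb _ ->]]; rewrite mul1r -nb -[sumn b]add0n; apply: mon_Ipow => //.
by rewrite Ipow0.
Qed.

(* Leading coefficients at the monomial [y ^ a] of relations, for the order that compares degrees first and then lexicographically. *)
Definition lead_sub (a : seq nat) : V -> Prop :=
  colon (gsp (Ipow (sumn a).+1) (monset 1 y (sumn a) (lexlt^~ a))) (1 * mon y a).

Lemma finlen_Ipow0 n : finlen (Ipow n) (@full V).
Proof.
have := finlen_Ipow n nR lm nV ny (@null_submod _ V).
suff -> : sadd (Ipow n) (@null _ V) = Ipow n by [].
apply: pred_ext; last by apply: sub_saddl; apply: null_submod.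
apply: sadd_sub => [|//|v ->]; first exact: Ipow_submod.
exact: submod0 (Ipow_submod _ _ _).
Qed.

Lemma ell_Ipow n : ell (Ipow n) = cumsum (size y) (fun a => ell (lead_sub a)) n.
Proof.
elim: n => [|n IH]; first by rewrite Ipow0 /cumsum big_nil; apply: qlenxx.
rewrite /cumsum big_nat_recr //= -/(cumsum _ _ n) -IH addnC.
have full_ok v : Ipow n v -> @full V v by [].
rewrite {1}/ell (qlen_add (Ipow_submod V y n) (@IpowS _ V y n) full_ok (finlen_Ipow0 _)).
congr (_ + _)%N; rewrite {1}[Ipow n]Ipow_gsp monomial_filtration //; last exact: finlen_Ipow0.
  by apply: degsum_ext => a sa na; rewrite /lead_sub na.
exact: Ipow_submod.
Qed.

Lemma lead_sub_submod a : is_submod (lead_sub a).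
Proof. by apply: colon_submod; apply: gsp_submod. Qed.

Lemma Ipow1_lead_sub a : size a = size y -> sub (Ipow 1) (lead_sub a).
Proof.
move=> sa v hv; rewrite /lead_sub /colon mul1r; apply: gsp_base.
by rewrite -add1n; apply: mon_Ipow.
Qed.

(** Multiplication by [mon y e] carries a relation led by y^a to one led by y^(a+e): it raises all
    degrees equally and keeps the lexicographic order. *)
Lemma lead_sub_mono a b : size a = size y -> all2 leq a b -> sub (lead_sub a) (lead_sub b).
Proof.
move=> sa /all2_leq_padd [e [se ->]] v; rewrite /lead_sub /colon !mul1r monD ?se ?sa //.
rewrite mulrC -scalerA sumn_padd ?se // => h.
have hF := colon_submod (mon y e) (gsp_submod (Ipow (sumn a + sumn e).+1)
  (monset 1 y (sumn a + sumn e) (lexlt^~ (padd a e)))).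
apply: (gsp_min hF _ _ h) => [u hu|x u [b' [sb nb lt ->]]].
  by rewrite /colon; apply: gsp_base; rewrite -addSn; apply: mon_Ipow; rewrite ?se ?sa.
rewrite /colon mul1r scalerA mulrC -monD ?se ?sa //; apply: gsp_gen; exists (padd b' e).
by rewrite mul1r size_padd ?sumn_padd ?lexlt_padd ?nb ?se ?sa.
Qed.

Lemma hs_antitone : antitone (size y) (fun a => ell (lead_sub a)).
Proof.
move=> a b sa sb ab; have ok P v : P v -> @full V v by [].
have [_ fa] := finlen_sub (lead_sub_submod a) (Ipow1_lead_sub sa) (ok _) (finlen_Ipow0 1).
rewrite /ell (qlen_add (lead_sub_submod b) (lead_sub_mono sa ab) (ok _) fa).
exact: leq_addl.
Qed.

Lemma hilbert_samuel : exists c : nat, polylike (size y) c%:Z (fun n => (ell (Ipow n))%:Z).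
Proof.
have [a [_ h]] := cumsum_polylike hs_antitone; exists (ell (lead_sub a)).
by apply: (polylike_ext (n0 := 0%N)) h => n _; rewrite ell_Ipow.
Qed.

Lemma mon_not_leq a b u : size a = size y -> size b = size y -> ~~ all2 leq b a ->
  IM V (powS y a) (mon y b *: u).
Proof.
elim: (y) a b u => [|x s IH] [|i a] [|j b] u //= [sa] [sb]; rewrite negb_and -ltnNge.
rewrite /powS /= -/(powS s a) => /orP[lt|/(IH _ _ _ sa sb) h].
  rewrite -(subnK lt) exprD -mulrA [x ^+ i.+1 * _]mulrC mulrA mulrC -scalerA.
  by apply: IM_gen; rewrite inE eqxx.
rewrite -scalerA; apply: submodZ; first exact: IM_submod.
by apply: IM_subset (h u) => z zs; rewrite inE zs orbT.
Qed.

(** Monomials of larger degree than y^a, and lexicographically smaller ones of the same degree, have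
    an exponent exceeding that of [a]. So they lie in the ideal of [powS y a], and [colon_mon]
    yields yV. *)
Lemma hilbert_samuel_regular w : (forall a, a \in w -> m a) -> regB (@null _ V) w ->
  size w = size y -> polylike (size y) (ell (IM V y))%:Z (fun n => (ell (Ipow n))%:Z).
Proof.
move=> wm reg sw; have [a [sa h]] := cumsum_polylike hs_antitone.
suff <- : lead_sub a = IM V y.
  by apply: (polylike_ext (n0 := 0%N)) h => n _; rewrite ell_Ipow.
apply: pred_ext; last by rewrite -Ipow1; apply: Ipow1_lead_sub.
move=> v; rewrite /lead_sub /colon mul1r => h'.
apply: (@colon_mon _ m V w wm reg y [::] a) => //.
apply: (gsp_min _ _ _ h'); first exact: IM_submod.
  apply: IM_min; first exact: IM_submod.
  move=> x u /powgens_mon [b [sb nb ->]]; apply: mon_not_leq => //.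
  by apply/negP => /all2_leq_sumn [le _]; move: le; rewrite nb ltnn.
move=> x u [b [sb nb lt ->]]; rewrite mul1r; apply: mon_not_leq => //.
apply/negP => /all2_leq_sumn [_ /(_ nb) e].
by move: lt; rewrite e lexlt_irr.
Qed.

(* Multiplication by an element of (y) maps I^n V into I^{n+1} V; summing the resulting difference inequality raises the degree by one. *)
Lemma hilbert_samuel_bound k : forall B : V -> Prop, is_submod B ->
  dlt (fun r => forall v : V, B (r *: v)) k.+1 ->
  exists c E, polylike k c E /\ forall n, ((ell (sadd (Ipow n) B))%:Z <= E n)%R.
Proof.
elim: k => [|k IH] B hB hd.
  have hi := quot_ann_ideal hB.
  have fB : finlen B (@full V).
    apply: (finlen_of_nil nR lm nV hB) => r mr v.
    by have [j hj] := nil_of_dlt1 nR lm hi hd mr; exists j.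
  exists (ell B)%:Z, (fun _ => (ell B)%:Z); split; first by exists 0%N.
  move=> n; have hIB : is_submod (sadd (Ipow n) B) by apply: sadd_submod => //; apply: Ipow_submod.
  have s1 : sub B (sadd (Ipow n) B) by apply: sub_saddr; apply: Ipow_submod.
  by rewrite lez_nat /ell (qlen_add hIB s1 (fun v _ => I) fB) leq_addl.
have hi := quot_ann_ideal hB.
(* Such a parameter exists inside (y) because (y) with the annihilator of V/B is contained in no
   prime except [m]. *)
have [|a [ha hda]] := @parameter_exists _ nR _ (igen (fun r => r \in y)) k.+1 hi (igen_ideal _) hd.
  suff h1 : dlt (fun r => (forall v : V, B (r *: v)) \/ igen (fun r => r \in y) r) 1.
    by move=> c n /h1; lia.
  apply: (dlt1_of_nil nR lm) => r /ny [j hj]; exists j; apply: igen_mono hj => t [ht|ht].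
    by left=> v; rewrite ht; apply: submod0.
  by right; apply: igen_mem.
pose B' := sadd B (simg V a).
have hB' : is_submod B' by apply: sadd_submod => //; apply: simg_submod.
have [|c [E [hE le]]] := IH B' hB'.
  apply: dlt_sub hda => r [hr|->] v; first by apply: sub_saddl; [apply: simg_submod|].
  by apply: sub_saddr => //; exists v.
pose f n := (ell (sadd (Ipow n) B))%:Z.
have step n : f n.+1 <= f n + E n.+1.
  rewrite /f; pose B1 := sadd (Ipow n.+1) B.
  have hB1 : is_submod B1 by apply: sadd_submod => //; apply: Ipow_submod.
  have f1 : finlen B1 (@full V) by exact: (finlen_Ipow n.+1 nR lm nV ny hB).
  have ok P v : P v -> @full V v by [].
  pose C := sadd B1 (simg V a).
  have hC : is_submod C by apply: sadd_submod => //; apply: simg_submod.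
  have B1C : sub B1 C by apply: sub_saddl; apply: simg_submod.
  rewrite -/B1 {1}/ell (qlen_add hC B1C (ok _) f1) colon_qlen // PoszD.
  have eC : C = sadd (Ipow n.+1) B'.
    apply: pred_ext => v.
      by move=> [_ [s [[i [b [hi' [hb ->]]]] [hs ->]]]]; exists i, (b + s); rewrite addrA; do !split=> //; exists b, s.
    by move=> [i [_ [hi' [[b [s [hb [hs ->]]]] ->]]]]; exists (i + b), s; rewrite addrA; do !split=> //; exists i, b.
  apply: lerD; last by rewrite eC; apply: le.
  rewrite lez_nat /ell.
  have hIB : is_submod (sadd (Ipow n) B) by apply: sadd_submod => //; apply: Ipow_submod.
  have fn : finlen (sadd (Ipow n) B) (@full V) by exact: (finlen_Ipow n nR lm nV ny hB).
  rewrite (qlen_add (colon_submod a hB1) _ (ok _) fn) ?leq_addl //.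
  apply: sadd_sub; first exact: colon_submod.
    move=> v hv; apply: sub_saddl => //; apply: Ipow_mul => //.
    by apply: igen_mono ha => t; right.
  by move=> v hv; apply: sub_saddr; [apply: Ipow_submod|apply: submodZ].
exists c, (fun n => f 0%N + \sum_(0 <= i < n) E i.+1); split.
  exists (fun n => E n.+1); split; first exact: polylike_shiftS.
  by exists 0%N => n _; rewrite big_nat_recr //=; ring.
elim=> [|n IHn]; first by rewrite big_nil addr0.
apply: le_trans (step n) _; rewrite big_nat_recr //= addrA; exact: lerD.
Qed.

End HilbertSamuel.

(** * Multiplicity, determinants and choice of parameters *)

Lemma poly_eq_nat (P Q : {poly rat}) n0 :
  (forall n, (n0 <= n)%N -> P.[n%:R] = Q.[n%:R]) -> P = Q.
Proof.
move=> h; apply/eqP; rewrite -subr_eq0; apply/negPn/negP => nz.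
pose rs : seq rat := [seq i%:R | i <- iota n0 (size (P - Q))].
have : (size rs < size (P - Q)%R)%N.
  apply: max_poly_roots nz _ _.
    apply/allP => x /mapP [i]; rewrite mem_iota => /andP[le _] ->.
    by rewrite /root hornerD hornerN h ?subrr.
  by rewrite map_inj_uniq ?iota_uniq // => i j /eqP; rewrite eqr_nat => /eqP.
by rewrite size_map size_iota ltnn.
Qed.

(** Polynomials that agree at all large natural numbers are equal, so the epsilon choice returns the
    coefficient of the constructed one. *)
Lemma emult_polylike (R : comNzRingType) (V : lmodType R) (y : seq R) (c : nat) :
  polylike (size y) c%:Z (fun n => (ell (Ipow V y n))%:Z) -> emult V y = c.
Proof.
move=> /polylike_poly [P [sP [lP [n0 hP]]]].
have hc : is_mult V y c.
  by exists P; split=> //; split=> //; exists n0 => n /hP <-.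
have [Q [_ [lQ [n1 hQ]]]] : is_mult V y (emult V y) by apply: epsilon_spec; exists c.
have e : P = Q.
  apply: (@poly_eq_nat _ _ (maxn n0 n1)) => n le.
  by rewrite -hP -?hQ //; lia.
move: lP; rewrite e lQ => /(mulIf _) h; apply/eqP; rewrite -(eqr_nat rat); apply/eqP.
by apply: h; rewrite invr_eq0 pnatr_eq0 -lt0n fact_gt0.
Qed.

Section Determinants.
Variable R : comNzRingType.

(* Replace the rows of E by those of F one at a time; a matrix with one row orthogonal to y is handled by Cramer's rule. *)
Lemma det_exchange (J : R -> Prop) d (E F : 'M[R]_d) (y w : 'I_d -> R) : is_ideal J ->
  (forall i, J (\sum_j E i j * y j - w i)) -> (forall i, J (\sum_j F i j * y j - w i)) ->
  (forall i, J (w i ^+ 2)) -> J (\prod_i w i * (\det E - \det F)).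
Proof.
move=> hJ hE hF hw.
pose H (k : nat) : 'M[R]_d := \matrix_(i, j) if (i < k)%N then F i j else E i j.
have H0 : H 0%N = E by apply/matrixP => i j; rewrite mxE.
have Hd : H d = F by apply/matrixP => i j; rewrite mxE ltn_ord.
have hH k i : J (\sum_j H k i j * y j - w i).
  rewrite (_ : \sum_j _ = \sum_j (if (i < k)%N then F i j else E i j) * y j); last first.
    by apply: eq_bigr => j _; rewrite mxE.
  by case: (i < k)%N.
have step k : (k < d)%N -> J (\prod_i w i * (\det (H k) - \det (H k.+1))).
  move=> lt; pose i0 := Ordinal lt.
  (* Row [i0] is the difference of two rows that both send y to [w i0], so it is orthogonal to y
     modulo [J]. *)
  pose G : 'M[R]_d := \matrix_(i, j) if i == i0 then E i j - F i j else H k i j.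
  have eG : \det G = \det (H k) - \det (H k.+1).
    rewrite (@determinant_multilinear _ _ G (H k) (H k.+1) i0 1 (-1)) ?mul1r ?mulN1r //.
    - by apply/rowP => j; rewrite !mxE eqxx ltnn ltnSn mul1r mulN1r.
    - apply/matrixP => i j; rewrite !mxE [lift _ _ == _]eq_sym (negPf (neq_lift _ _)) ?mxE //.
    apply/matrixP => i j; rewrite !mxE [lift _ _ == _]eq_sym (negPf (neq_lift _ _)) ?mxE.
    have : lift i0 i != i0 by rewrite eq_sym neq_lift.
    by rewrite -(inj_eq val_inj) ltnS leq_eqVlt => /negPf ->.
  rewrite -eG (bigD1 i0) //=; set W := \prod_(i | _) _.
  (* [W] already contains [w i], and its square is in [J]; this is the purpose of the product in the
     statement. *)
  have Ww i : i != i0 -> J (W * w i).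
    move=> ne; rewrite /W (bigD1 i) //= mulrC mulrA -expr2; exact: idlMr.
  have Gy l : J (W * (\det G * y l)).
    have := @det_kills R R^o d G y l; rewrite /GRing.scale /= => ->.
    rewrite mulr_sumr; apply: idl_sum => // i _; rewrite mulrCA; apply: idlMl => //.
    have [->|ne] := eqVneq i i0.
      apply: idlMl => //; under eq_bigr do rewrite mxE eqxx mulrBl.
      rewrite sumrB; have -> : \sum_i E i0 i * y i - \sum_i F i0 i * y i =
        (\sum_i E i0 i * y i - w i0) + - (\sum_i F i0 i * y i - w i0) by ring.
      by apply: idlD => //; apply: idlN.
    under eq_bigr do rewrite mxE (negPf ne).
    rewrite -(subrK (w i) (\sum_j _)) mulrDr; apply: idlD => //; last exact: Ww.
    by apply: idlMl.
  (* The factor [w i0] is exchanged for row [i0] of [E] applied to y, since each W det(G) y_j is in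
     [J]. *)
  have -> : w i0 * W * \det G = - ((\sum_j E i0 j * y j - w i0) * (W * \det G)) +
      \sum_j E i0 j * (W * (\det G * y j)).
    rewrite mulrBl mulr_suml -mulrA.
    have -> : \sum_i E i0 i * y i * (W * \det G) = \sum_j E i0 j * (W * (\det G * y j)).
      by apply: eq_bigr => j _; ring.
    ring.
  apply: idlD => //; first by apply: idlN => //; apply: idlMr.
  by apply: idl_sum => // j _; apply: idlMl.
rewrite -H0 -Hd; have : forall k, (k <= d)%N -> J (\prod_i w i * (\det (H 0%N) - \det (H k))).
  elim=> [_|k IH lt]; first by rewrite subrr mulr0; apply: idl0.
  have -> : \prod_i w i * (\det (H 0%N) - \det (H k.+1)) =
    \prod_i w i * (\det (H 0%N) - \det (H k)) + \prod_i w i * (\det (H k) - \det (H k.+1)) by ring.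
  by apply: idlD => //; [apply: IH; apply: ltnW|apply: step].
by apply.
Qed.

(** In the application [S] is the image of M. With [w i] = y_i^(s+1), the exponent 2s+1 is s+1 from
    [w i] plus s from det F, and 2s+2 is that of [w i ^+ 2]: the t and t+1 of the limit closure. *)
Lemma limit_closure_core (V : lmodType R) (S : V -> Prop) d (y z : 'I_d -> R)
    (A C : 'M[R]_d) s (i1 i2 : 'I_d) v (u : 'I_d -> V) :
  is_submod S -> i1 != i2 -> (forall x, S (z i1 *: x)) -> (forall x, S (z i2 *: x)) ->
  (forall i, z i = \sum_j A i j * y j) ->
  (forall i, ann V (\sum_j C i j * z j ^+ 2 - y i ^+ s.+1)) ->
  S v -> v = \sum_i y i *: u i ->
  exists u', (forall i, S (u' i)) /\
    \prod_i y i ^+ (s.*2.+1) *: v = \sum_i y i ^+ (s.*2.+2) *: u' i.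
Proof.
move=> hS ne S1 S2 hz hC Sv ev; pose w i := y i ^+ s.+1.
pose T k (x : V) := exists u', (forall i, S (u' i)) /\ x = \sum_i w i ^+ k *: u' i.
have hT k : is_submod (T k).
  split; first by exists (fun _ => 0); split=> [i|]; [apply: submod0|rewrite big1 // => i _; rewrite scaler0].
  split=> [a b [ua [ha ->]] [ub [hb ->]]|r a [ua [ha ->]]].
    exists (fun i => ua i + ub i); split=> [i|]; first exact: submodD.
    by rewrite -big_split; apply: eq_bigr => i _; rewrite scalerDr.
  exists (fun i => r *: ua i); split=> [i|]; first exact: submodZ.
  by rewrite scaler_sumr; apply: eq_bigr => i _; rewrite !scalerA mulrC.
have Tgen k i x : S x -> T k (w i ^+ k *: x).
  move=> Sx; exists (fun j => if j == i then x else 0); split=> [j|].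
    by case: eqP => _ //; apply: submod0.
  by rewrite (bigD1 i) //= eqxx big1 ?addr0 // => j /negPf ->; rewrite scaler0.
suff [u' [hu' e]] : T 2 (\prod_i y i ^+ (s.*2.+1) *: v).
  exists u'; split=> //; rewrite e; apply: eq_bigr => i _.
  by rewrite /w -exprM; congr (_ ^+ _ *: _); lia.
(* Up to the annihilator of V both matrices send y to w: [F] directly, [E] by way of A y = z and C
   z^2. *)
pose E : 'M[R]_d := C *m diag_mx (\row_j z j) *m A.
pose F : 'M[R]_d := diag_mx (\row_j y j ^+ s).
have hJ := colon_ideal S (hT 2%N).
have JV r : ann V r -> forall l, S l -> T 2 (r *: l).
  by move=> hr l _; rewrite hr; apply: submod0 (hT _).
have Ey i : \sum_j E i j * y j = \sum_j C i j * z j ^+ 2.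
  transitivity (\sum_l C i l * z l * (\sum_j A l j * y j)).
    under eq_bigr => j _ do rewrite /E mxE mulr_suml.
    rewrite exchange_big; apply: eq_bigr => l _ /=; rewrite mulr_sumr; apply: eq_bigr => j _.
    by rewrite mul_mx_diag !mxE mulrA.
  by apply: eq_bigr => l _; rewrite -hz -mulrA -expr2.
have Fy i : \sum_j F i j * y j = w i.
  rewrite (bigD1 i) //= big1 ?addr0; last first.
    by move=> j; rewrite eq_sym !mxE => /negPf ->; rewrite mulr0n mul0r.
  by rewrite !mxE eqxx mulr1n -exprSr.
have hdet : forall l, S l -> T 2%N ((\prod_i w i * (\det E - \det F)) *: l).
  apply: (det_exchange (y := y) hJ) => i.
  - by rewrite Ey; apply: JV.
  - by move=> l Sl; rewrite Fy subrr scale0r; apply: submod0 (hT _).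
  - by move=> l; apply: Tgen.
have {hdet} := hdet _ Sv.
have detE : \det E = \det C * \prod_i z i * \det A.
  by rewrite !det_mulmx det_diag; congr (_ * _ * _); apply: eq_bigr => i _; rewrite mxE.
have detF : \det F = \prod_i y i ^+ s by rewrite det_diag; apply: eq_bigr => i _; rewrite mxE.
rewrite mulrBr scalerBl => hdet.
have -> : \prod_i y i ^+ (s.*2.+1) = \prod_i w i * \det F.
  by rewrite detF -big_split /=; apply: eq_bigr => i _; rewrite -exprD; congr (_ ^+ _); lia.
suff TE : T 2%N ((\prod_i w i * \det E) *: v).
  have := submodB (hT 2%N) TE hdet; by rewrite subKr.
(* The factor [w i] of the product squares the one in front of [u' i]; the other factors are
   absorbed by [S]. *)
have T12 x : T 1%N x -> T 2%N (\prod_i w i *: x).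
  move=> [u' [hu' ->]]; rewrite scaler_sumr; apply: submod_sum => // i _.
  rewrite expr1 scalerA (bigD1 i) //= mulrAC -expr2 -scalerA; apply: Tgen; exact: submodZ.
rewrite -scalerA; apply: T12; rewrite detE -mulrA -scalerA.
(* The product of the z's without z l still contains z i1 or z i2. *)
have [n en] : exists n : 'I_d -> V, (\prod_i z i * \det A) *: v = \sum_l z l ^+ 2 *: n l /\
    forall l, S (n l).
  exists (fun l => \prod_(i | i != l) z i *: \sum_i (\adj A) i l *: u i); split.
    rewrite -scalerA ev scaler_sumr.
    have -> : \sum_i \det A *: (y i *: u i) = \sum_l z l *: \sum_i (\adj A) i l *: u i.
      transitivity (\sum_i \sum_l (\adj A i l * z l) *: u i).
        apply: eq_bigr => i _; rewrite scalerA -scaler_suml; congr (_ *: _).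
        have := @det_kills R R^o d A y i; rewrite /GRing.scale /= => ->.
        by apply: eq_bigr => l _; rewrite hz.
      rewrite exchange_big; apply: eq_bigr => l _ /=; rewrite scaler_sumr.
      by apply: eq_bigr => i _; rewrite scalerA mulrC.
    rewrite scaler_sumr; apply: eq_bigr => l _.
    by rewrite (bigD1 l) //= !scalerA mulrAC -expr2.
  move=> l; have [e|ne1] := eqVneq i1 l.
    have ne2 : i2 != l by rewrite -e eq_sym.
    by rewrite (bigD1 i2) //= -scalerA.
  by rewrite (bigD1 i1) //= -scalerA.
case: en => -> hn; rewrite scaler_sumr; apply: submod_sum => // l _.
(* By Cramer's rule det C converts each z_l^2 into a combination of the [w i], up to the
   annihilator. *)
have dC : \det C * z l ^+ 2 = \sum_i \adj C l i * \sum_j C i j * z j ^+ 2.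
  exact: (@det_kills R R^o d C (fun j => z j ^+ 2) l).
rewrite scalerA dC.
rewrite scaler_suml; apply: submod_sum => // i _.
have -> : (\adj C l i * (\sum_j C i j * z j ^+ 2)) *: n l = w i ^+ 1 *: (\adj C l i *: n l).
  rewrite expr1 mulrC -!scalerA -[X in X *: _](subrK (w i)) scalerDl hC add0r.
  by [].
by apply: Tgen; apply: submodZ.
Qed.
End Determinants.

Section ParameterChoice.
Variables (R : comNzRingType) (m : R -> Prop).
Hypotheses (nR : noetherian_ring R) (lm : local_ring_with m).

Lemma dlt_igen (G H : R -> Prop) k : sub H (igen G) -> dlt H k -> dlt G k.
Proof.
move=> HG h c n [h1 [h2 h3]]; apply: (h c); split=> //; split=> // r /HG hr.
by apply: hr => //; have [] := h1 0%N (leq0n _).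
Qed.

Lemma dlt_leq (G : R -> Prop) k l : (k <= l)%N -> dlt G k -> dlt G l.
Proof. by move=> kl h c n /h; lia. Qed.

Lemma parameters_exist (I : R -> Prop) k : is_ideal I -> forall a, is_ideal a ->
  dlt a k.+1 -> dlt (fun r => a r \/ I r) 1 ->
  exists z, [/\ size z = k, forall c, c \in z -> I c & dlt (fun r => a r \/ r \in z) 1].
Proof.
move=> hI; elim: k => [|k IH] a ha da dI.
  by exists [::]; split=> //; apply: dlt_sub da => r; left.
have [|c [Ic dc]] := parameter_exists nR ha hI da; first exact: dlt_leq dI.
have [||z [sz zI dz]] := IH _ (iadd_ideal c ha).
- by apply: dlt_sub dc => r [ar| ->]; [apply: sub_iadd|apply: iadd_mem].
- by apply: dlt_sub dI => r [ar|Ir]; [left; apply: sub_iadd|right].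
exists (c :: z); split; first by rewrite /= sz.
  by move=> b; rewrite inE => /orP[/eqP->|/zI].
apply: dlt_igen dz => r [[i [e [ai ->]]]|rz].
  apply: (idlD (igen_ideal _)); first by apply: igen_mem; left.
  by apply: (idlMl _ (igen_ideal _)); apply: igen_mem; right; rewrite inE eqxx.
by apply: igen_mem; right; rewrite inE rz orbT.
Qed.

End ParameterChoice.

(** * The limit closure and the multiplicity of M *)

Section LimitClosure.
Variables (R : comNzRingType) (V : lmodType R).

Lemma powS_nseq (y : seq R) t : powS y (nseq (size y) t) = [seq a ^+ t.+1 | a <- y].
Proof. by elim: y => //= a y IH; rewrite /powS /= -/(powS y _) IH. Qed.

Lemma mon_nseq (y : seq R) t : mon y (nseq (size y) t) = \prod_(a <- y) a ^+ t.
Proof. by elim: y => [|a y IH] /=; rewrite ?big_nil ?big_cons ?IH. Qed.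

Lemma IM_sub_limcl (y : seq R) : sub (IM V y) (limcl y).
Proof.
suff h : sub (IM V y) (colon (IM V [seq a ^+ 2 | a <- y]) (\prod_(a <- y) a ^+ 1)).
  by move=> v /h hv; exists 1%N.
apply: IM_min; first exact: (colon_submod _ (IM_submod _ _)).
move=> a u ay; rewrite /colon scalerA (big_rem a) //= expr1 mulrAC -expr2 -scalerA.
by apply: IM_gen; apply/mapP; exists a.
Qed.

End LimitClosure.

(** * The exact sequence 0 -> M -> M' -> N -> 0 *)

Section Macaulayfication.
Variables (R : comNzRingType) (m : R -> Prop) (M M' N : lmodType R).
Variables (f : {linear M -> M'}) (g : {linear M' -> N}).
Hypotheses (nR : noetherian_ring R) (lm : local_ring_with m).
Hypotheses (fgM : fin_gen M) (fgM' : fin_gen M') (finj : injective f).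
Hypothesis gsur : forall z : N, exists w, g w = z.
Hypothesis fg_exact : forall w, g w = 0 <-> exists v, w = f v.

Let S : M' -> Prop := imgp f (@full M).

Lemma f_linear : is_linear f.
Proof. by split=> [u v|r v]; [rewrite linearD|rewrite linearZ]. Qed.
Lemma g_linear : is_linear g.
Proof. by split=> [u v|r v]; [rewrite linearD|rewrite linearZ]. Qed.

Lemma S_submod : is_submod S. Proof. by apply: imgp_submod; [apply: f_linear|]. Qed.
Lemma S_ker w : S w <-> g w = 0.
Proof. by rewrite fg_exact; split=> [[v [_ ->]]|[v ->]]; exists v. Qed.

Lemma ell_pull (B : M' -> Prop) : is_submod B ->
  ell (fun v => B (f v)) = qlen B (sadd B S).
Proof.
move=> hB; have hS := S_submod; apply: (iso_qlen f_linear) => //.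
- exact: preim_submod f_linear _ hB.
- exact: sadd_submod.
- exact: sub_saddl.
- by move=> v _; apply: sub_saddr => //; exists v.
- by move=> w [b [_ [Bb [[v [_ ->]] ->]]]]; exists v; rewrite addrK.
Qed.

Lemma ell_split (B : M' -> Prop) : is_submod B -> finlen B (@full M') ->
  ell B = (ell (fun v => B (f v)) + ell (sadd B S))%N.
Proof.
move=> hB fB; have hS := S_submod; have hBS := sadd_submod hB hS.
by rewrite ell_pull // {1}/ell (qlen_add hBS (sub_saddl hS) (fun v _ => I) fB).
Qed.

Lemma ell_push (y : seq R) : ell (sadd (IM M' y) S) = ell (IM N y).
Proof.
have hS := S_submod; have hy := IM_submod M' y; have hBS := sadd_submod hy hS.
have hN := IM_submod N y; have [gD gZ] := g_linear.
apply: (iso_qlen g_linear) => // [w _|v _].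
  by have [v <-] := gsur w; exists v; rewrite subrr; split=> //; apply: submod0.
split.
  have : sub (IM N y) (imgp g (IM M' y)).
    apply: IM_min; first exact: imgp_submod g_linear _ hy.
    move=> a u ay; have [u' <-] := gsur u; exists (a *: u'); rewrite gZ; split=> //.
    exact: IM_gen.
  move=> h /h [v' [hv' e]]; exists v', (v - v'); rewrite [v' + _]addrC subrK; split=> //; split=> //.
  by apply/S_ker; rewrite (linB g_linear) e subrr.
move=> [a [b [ha [/S_ker gb ->]]]]; rewrite gD gb addr0.
move: a ha; apply: IM_min; first exact: preim_submod g_linear _ hN.
by move=> a u ay; rewrite gZ; apply: IM_gen.
Qed.

Lemma IM_f (y : seq R) v : IM M y v -> IM M' y (f v).
Proof.
have [fD fZ] := f_linear.
move: v; apply: IM_min; first exact: preim_submod f_linear _ (IM_submod _ _).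
by move=> a u ay; rewrite fZ; apply: IM_gen.
Qed.

Lemma annN_S r w : ann N r -> S (r *: w).
Proof. by move=> hr; apply/S_ker; have [_ gZ] := g_linear; rewrite gZ hr. Qed.

Lemma ann_f : sub (ann M') (ann M).
Proof. by move=> r hr v; apply: finj; have [_ fZ] := f_linear; rewrite fZ hr (lin0 f_linear). Qed.

(** If the lowest prime of a chain over Ann M' contains Ann N, the chain is short. Otherwise pick s
    in Ann N outside it: since sM' lies in M, s Ann M kills M', and the prime contains Ann M. *)
Lemma dim_middle d : dim_eq M d -> dlt (ann N) d -> dim_eq M' d.
Proof.
move=> [le [c [c1 [c2 c3]]]] dN; split; last by exists c; split=> //; split=> // a /ann_f; apply: c3.
move=> q n [h1 [h2 h3]]; have [hq [_ qp]] := h1 0%N (leq0n _).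
have [annN|/not_sub [s [sN ns]]] := classic (sub (ann N) (q 0%N)).
  by rewrite lez_nat ltnW //; apply: (dN q); split=> //; split.
apply: (le q); split=> //; split=> // r rM.
have [|//|/ns //] := qp r s _; apply: h3 => w.
have [v [_ e]] := annN_S w sN.
by rewrite -scalerA e; have [_ fZ] := f_linear; rewrite -fZ rM (lin0 f_linear).
Qed.

Section Equality.
Variables (d : nat) (w y : seq R).
Hypotheses (wm : forall a, a \in w -> m a) (regw : regB (@null _ M') w) (sw : size w = d).
Hypotheses (dN : dlt (ann N) d.-1) (dM' : dlt (ann M') d.+1).

(** If r kills M, then Ann N kills rM', because sM' lies in M for s in Ann N; unmixedness of M' then
    forces rM' = 0. *)
Lemma ann_eq : sub (ann M) (ann M').
Proof.
move=> r rM; have nM' := fg_noeth nR fgM'; have [_ fZ] := f_linear.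
suff : sub (simg M' r) (@null _ M') by move=> h u; apply: h; exists u.
apply: NNPP => h.
apply: (unmixed nR lm nM' (@null_submod _ M') (simg_submod M' r) wm regw h (b := ann N)).
  move=> s l sN [u ->]; have [v [_ e]] := annN_S u sN.
  by rewrite /null scalerA mulrC -scalerA e -fZ rM (lin0 f_linear).
by rewrite sw; apply: dlt_leq dN; apply: leq_pred.
Qed.

Hypotheses (sy : size y = d) (ym : forall a, a \in y -> m a) (yM : mprimary m M y).

Lemma mprimary_M' : mprimary m M' y.
Proof.
move=> r /yM [k hk]; exists k; apply: igen_mono hk => a [/ann_eq ha|ha]; [by left|by right].
Qed.

Lemma surjective_small : (d < 2)%N -> forall u, S u.
Proof.
move=> d2 u; apply/S_ker; have /dlt0 : dlt (ann N) 0 by apply: dlt_leq dN; lia.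
by move=> /(_ nR (ann_ideal N)) /(_ (g u)); rewrite scale1r.
Qed.

(** Membership in (y) provides the matrix [A] with z = A y; the last clause, on [z1] alone, serves
    the comparison of multiplicities. *)
Lemma special_parameters : (1 < d)%N -> exists z1 z2 z,
  [/\ ann N z1 /\ ann N z2, size (z1 :: z2 :: z) = d,
      forall c, c \in z1 :: z2 :: z -> igen (fun r => r \in y) c,
      mprimary m M' (z1 :: z2 :: z) & dlt (fun r => ann M' r \/ r = z1) d].
Proof.
move=> d2; pose I := igen (fun r => r \in y); have hI : is_ideal I by apply: igen_ideal.
have ha := ann_ideal M'.
have dI (a : R -> Prop) : sub (ann M') a -> dlt (fun r => a r \/ I r) 1.
  move=> aa; apply: (dlt1_of_nil nR lm) => r /mprimary_M' [k hk]; exists k.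
  apply: igen_mono hk => t [ht|ht]; first by left; apply: aa.
  by right; apply: igen_mem.
pose b r := ann N r /\ I r.
have hb : is_ideal b.
  have hN := ann_ideal N; split; first by split; apply: idl0.
  split=> [r s [rN rI] [sN sI]|t r [rN rI]]; split.
  - exact: (idlD hN).
  - exact: (idlD hI).
  - exact: (idlMl _ hN).
  - exact: (idlMl _ hI).
(* A prime over [b] contains Ann N or (y). In the first case chains are shorter than d-1; in the
   second they have length 0, which is below d-1 since d >= 2. *)
have db (a : R -> Prop) : sub (ann M') a -> dlt (fun r => a r \/ b r) d.-1.
  move=> aa c n hc; have [h1 [h2 h3]] := hc.
  have [hc0 [_ cp]] := h1 0%N (leq0n _).
  have [NC|/not_sub [s [sN ns]]] := classic (sub (ann N) (c 0%N)).
    by apply: (dN (c := c)); split=> //; split.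
  have : (n < 1)%N; last by lia.
  apply: (dI a aa c); split=> //; split=> // r [ar|rI]; first by apply: h3; left.
  have [||//] := cp s r; last by [].
  by apply: h3; right; split; [apply: (idlMr _ (ann_ideal N))|apply: (idlMl _ hI)].
have [|z1 [[z1N z1I] d1]] := parameter_exists nR ha hb (k := d) dM'.
  by apply: (dlt_leq (leq_pred d)); apply: db.
pose a1 := iadd (ann M') z1; have ha1 : is_ideal a1 by apply: iadd_ideal.
have aa1 : sub (ann M') a1 by apply: sub_iadd.
have d1' : dlt a1 d.-1.+1.
  by rewrite prednK ?(ltnW d2) //; apply: dlt_sub d1 => r [|->]; [apply: sub_iadd|apply: iadd_mem].
have [|z2 [[z2N z2I] d2']] := parameter_exists nR ha1 hb (k := d.-1) d1'; first exact: db.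
pose a2 := iadd a1 z2; have ha2 : is_ideal a2 by apply: iadd_ideal.
have aa2 : sub (ann M') a2 by move=> r /aa1; apply: sub_iadd.
have [||z [sz zI dz]] := parameters_exist nR (k := d.-2) hI ha2.
- have -> : d.-2.+1 = d.-1 by lia.
  by apply: dlt_sub d2' => r [|->]; [apply: sub_iadd|apply: iadd_mem].
- exact: dI.
exists z1, z2, z; split=> //.
- by rewrite /= sz; lia.
- by move=> c; rewrite !inE => /or3P[/eqP->|/eqP->|/zI].
pose G r := ann M' r \/ r \in z1 :: z2 :: z.
have hG := igen_ideal G.
move=> r mr; apply: (nil_of_dlt1 nR lm hG _ mr).
apply: dlt_sub (_ : dlt G 1); first exact: igen_mem.
apply: dlt_igen dz => t [[_ [e [[i [c [hi ->]]] ->]]]|tz].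
  apply: (idlD hG); first apply: (idlD hG).
  - by apply: igen_mem; left.
  - by apply: (idlMl _ hG); apply: igen_mem; right; rewrite inE eqxx.
  by apply: (idlMl _ hG); apply: igen_mem; right; rewrite !inE eqxx orbT.
by apply: igen_mem; right; rewrite !inE tz !orbT.
Qed.

Lemma igen_sum G (s : seq R) n r : size s = n -> is_ideal G ->
  igen (fun a => G a \/ a \in s) r -> exists c : 'I_n -> R, G (\sum_j c j * s`_j - r).
Proof.
move=> <- hG; move: r; apply: igen_min.
  split; first by exists (fun _ => 0); rewrite big1 ?subrr => [|j _]; [apply: idl0|rewrite mul0r].
  split=> [a b [c hc] [e he]|t a [c hc]].
    exists (fun j => c j + e j).
    have -> : \sum_j (c j + e j) * s`_j - (a + b) = (\sum_j c j * s`_j - a) + (\sum_j e j * s`_j - b).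
      by under eq_bigr do rewrite mulrDl; rewrite big_split /=; ring.
    exact: idlD.
  exists (fun j => t * c j).
  have -> : \sum_j t * c j * s`_j - t * a = t * (\sum_j c j * s`_j - a).
    by rewrite mulrBr mulr_sumr; congr (_ - _); apply: eq_bigr => j _; rewrite mulrA.
  exact: idlMl.
move=> a [ha|hs].
  exists (fun _ => 0); rewrite big1 => [|j _]; last by rewrite mul0r.
  by rewrite add0r; apply: idlN.
have lt : (index a s < size s)%N by rewrite index_mem.
exists (fun j => if j == Ordinal lt then 1 else 0).
rewrite (bigD1 (Ordinal lt)) //= eqxx big1 => [|j /negPf ->]; last by rewrite mul0r.
by rewrite mul1r addr0 nth_index // subrr; apply: idl0.
Qed.

Lemma limcl_eq : limcl y = (fun v : M => IM M' y (f v)).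
Proof.
have [fD fZ] := f_linear; apply: pred_ext => v.
  move=> [t [_ /IM_f]]; rewrite fZ -powS_nseq -mon_nseq.
  apply: (colon_mon (m := m) wm regw (s := [::])); rewrite ?size_nseq ?sw ?sy //.
  exact: mprimary_M'.
(* For d < 2 the map [f] is onto, so yM' is the image of yM, and yM lies in the limit closure. *)
have [d2 h|d2] := ltnP d 2.
  apply: IM_sub_limcl; have : imgp f (IM M y) (f v); last by move=> [v' [h' /finj ->]].
  move: {v h} (f v) h; apply: IM_min; first exact: imgp_submod f_linear _ (IM_submod _ _).
  move=> a u ay; have [u' [_ ->]] := surjective_small d2 u.
  by exists (a *: u'); rewrite fZ; split=> //; apply: IM_gen.
move=> [us [_ ev]].
have [z1 [z2 [z [[z1N z2N] sz zI zp _]]]] := special_parameters d2.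
set zz := z1 :: z2 :: z in sz zI zp; pose y' (i : 'I_d) := y`_i; pose z' (i : 'I_d) := zz`_i.
have /fin_all_exists [A hA] : forall i : 'I_d, exists c : 'I_d -> R, z' i = \sum_j c j * y' j.
  move=> i; have zi : igen (fun r => r \in y) (z' i) by apply: zI; apply: mem_nth; rewrite sz.
  have h0 : is_ideal (fun r : R => r = 0).
    by split=> //; split=> [a b -> ->|t a ->]; rewrite ?addr0 ?mulr0.
  have [|c hc] := @igen_sum (fun r => r = 0) y d (z' i) sy h0; first by apply: igen_mono zi => t; right.
  by exists c; apply/eqP; rewrite eq_sym -subr_eq0; apply/eqP.
pose z2s := [seq a ^+ 2 | a <- zz].
have z2p : mprimary m M' z2s.
  have := @mprimary_powS R m M' [::] zz (nseq (size zz) 1) (size_nseq _ _) zp.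
  by rewrite powS_nseq.
(* Adding up the exponents found for the individual terms of y gives one that serves all of them. *)
have [s hs] : exists s, forall i : 'I_d, igen (fun a => ann M' a \/ a \in z2s) (y' i ^+ s.+1).
  have hi := igen_ideal (fun a => ann M' a \/ a \in z2s).
  have : exists s, forall a, a \in y -> igen (fun a => ann M' a \/ a \in z2s) (a ^+ s.+1).
    elim: (y) ym => [|a s IH] sm; first by exists 0%N.
    have [|k hk] := IH; first by move=> b bs; apply: sm; rewrite inE bs orbT.
    have [l hl] := z2p a (sm a (mem_head _ _)).
    exists (k + l)%N => b; rewrite inE => /orP[/eqP->|/hk h].
      by rewrite -addSn exprD; apply: (idlMl _ hi).
    by rewrite -addSn exprD; apply: (idlMr _ hi).
  by move=> [s hs]; exists s => i; apply: hs; apply: mem_nth; rewrite sy.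
have /fin_all_exists [C hC] : forall i : 'I_d, exists c : 'I_d -> R,
    ann M' (\sum_j c j * z' j ^+ 2 - y' i ^+ s.+1).
  move=> i; have [|c hc] := @igen_sum (ann M') z2s d (y' i ^+ s.+1) _ (ann_ideal M') (hs i).
    by rewrite size_map sz.
  exists c; move: hc; congr (ann M' (_ - _)); apply: eq_bigr => j _.
  by rewrite (nth_map 0) ?sz.
rewrite sy in ev.
have lt1 : (0 < d)%N by lia.
have [||||||u' [hu' eu]] := @limit_closure_core R M' S d y' z' (\matrix_(i, j) A i j)
  (\matrix_(i, j) C i j) s (Ordinal lt1) (Ordinal d2) (f v) (fun i => us`_i) S_submod isT.
- by move=> x; apply: annN_S.
- by move=> x; apply: annN_S.
- by move=> i; rewrite hA; apply: eq_bigr => j _; rewrite mxE.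
- move=> i; move: (hC i); congr (ann M' (_ - _)); apply: eq_bigr => j _.
  by rewrite mxE.
- by exists v.
- exact: ev.
have /fin_all_exists [p hp] : forall i, exists p, u' i = f p.
  by move=> i; have [p [_ e]] := hu' i; exists p.
exists s.*2.+1; split=> //; rewrite /colon.
have -> : \prod_(a <- y) a ^+ s.*2.+1 = \prod_i y' i ^+ s.*2.+1.
  by rewrite (big_nth 0) big_mkord sy.
have -> : \prod_i y' i ^+ s.*2.+1 *: v = \sum_i y' i ^+ s.*2.+2 *: p i.
  apply: finj; rewrite fZ eu linear_sum; apply: eq_bigr => i _.
  by rewrite hp fZ.
apply: submod_sum; first exact: IM_submod.
move=> i _; apply: IM_gen; apply/mapP; exists (y' i) => //.
by apply: mem_nth; rewrite sy.
Qed.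

(* The defects are N and M / f^-1(z1 M') for a parameter z1 in Ann N, both of smaller dimension; multiplication by z1 maps M' into M, which replaces an Artin-Rees argument. *)
Lemma multiplicity_eq c : polylike d c%:Z (fun n => (ell (Ipow M y n))%:Z) ->
  c = ell (IM M' y).
Proof.
move=> hM; have nM' := fg_noeth nR fgM'; have nM := fg_noeth nR fgM.
have yM' := mprimary_M'; have [fD fZ] := f_linear.
have := hilbert_samuel_regular nR lm nM' yM' wm regw; rewrite sw sy => /(_ erefl).
set e := ell (IM M' y) => hM'.
have ffin n := finlen_Ipow0 nR lm nM' yM' n.
have ffinM n := finlen_Ipow0 nR lm nM yM n.
have hI n := Ipow_submod M y n; have hI' n := Ipow_submod M' y n.
have pullI n : sub (Ipow M y n) (fun v => Ipow M' y n (f v)) by move=> v; apply: IM_f.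
have hpull n : is_submod (fun v => Ipow M' y n (f v)) := preim_submod f_linear (hI' n).
(* M/I^nM maps onto M/(M :&: I^nM'), where I = (y). *)
have low n : (ell (Ipow M' y n) <= ell (Ipow M y n) + ell (sadd (Ipow M' y n) S))%N.
  rewrite (ell_split (hI' n) (ffin n)) leq_add2r.
  by rewrite {2}/ell (qlen_add (hpull n) (pullI n) (fun v _ => I) (ffinM n)) leq_addl.
(* Each Hilbert function bounds the other up to an error with coefficient 0 in degree d, so the
   leading coefficients agree. *)
suff [E1 [E2 [p1 [p2 [h1 h2]]]]] : exists E1 E2, polylike d 0 E1 /\ polylike d 0 E2 /\
    (forall n, (ell (sadd (Ipow M' y n) S))%:Z <= E1 n) /\
    (forall n, (ell (Ipow M y n))%:Z <= (ell (Ipow M' y n))%:Z + E2 n).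
  have q1 := polylikeD (polylikeD hM p1) (polylikeN hM').
  have q2 := polylikeD (polylikeD hM' p2) (polylikeN hM).
  have := polylike_ge0 (n0 := 0%N) q1; have := polylike_ge0 (n0 := 0%N) q2.
  rewrite !addr0 !subr_ge0 => g2 g1; apply/eqP; rewrite eqn_leq -!lez_nat.
  apply/andP; split; [apply: g2|apply: g1] => n _; rewrite subr_ge0; first exact: h2.
  apply: le_trans (_ : _ <= (ell (Ipow M y n) + ell (sadd (Ipow M' y n) S))%N%:Z) _.
    by rewrite lez_nat.
  by rewrite PoszD lerD2l.
have hS := S_submod.
have [d2|d2] := ltnP d 2.
  have Sfull := surjective_small d2.
  exists (fun _ => 0), (fun _ => 0); do 2![split; first exact: polylike0_const]; split=> n.
    have -> : sadd (Ipow M' y n) S = @full M'; last by rewrite /ell qlenxx.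
    by apply: pred_ext => // u _; apply: sub_saddr.
  rewrite addr0 lez_nat (ell_split (hI' n) (ffin n)).
  suff -> : Ipow M y n = (fun v => Ipow M' y n (f v)) by apply: leq_addr.
  apply: pred_ext; first exact: pullI.
  move=> v h; have : imgp f (Ipow M y n) (f v); last by move=> [v' [h' /finj ->]].
  move: {v} (f v) h; apply: IM_min; first exact: imgp_submod f_linear _ (hI n).
  move=> a u ay; have [u' [_ ->]] := Sfull u.
  by exists (a *: u'); rewrite fZ; split=> //; apply: IM_gen.
have [k dk] : exists k, d = k.+2 by exists d.-2; lia.
have [z1 [z2 [z [[z1N _] _ _ _ dz]]]] := special_parameters d2.
have [|c1 [E1 [p1 h1]]] := hilbert_samuel_bound nR lm nM' yM' (k := k) hS.
  apply: dlt_sub (_ : dlt (ann N) k.+1); first by move=> r rN u; apply: annN_S.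
  by apply: dlt_leq dN; rewrite dk.
have phi_ex u : exists v, f v = z1 *: u.
  by have [v [_ e1]] := annN_S u z1N; exists v.
(* Multiplication by [z1] as a map from M' to M; it is linear because [f] is injective. *)
pose phi u := epsilon (inhabits (0 : M)) (fun v => f v = z1 *: u).
have phiE u : f (phi u) = z1 *: u := epsilon_spec (inhabits (0 : M)) (fun v => f v = z1 *: u) (phi_ex u).
have phi_lin : is_linear phi.
  split=> [u v|r v]; apply: finj; rewrite ?fD ?fZ !phiE ?scalerDr //.
  by rewrite !scalerA mulrC.
pose D (v : M) := simg M' z1 (f v).
have hD : is_submod D := preim_submod f_linear (simg_submod M' z1).
have Dphi v : D v -> exists u, v = phi u.
  by move=> [u eu]; exists u; apply: finj; rewrite phiE.
have [|c2 [E2 [p2 h2]]] := hilbert_samuel_bound nR lm nM yM (k := k.+1) hD.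
  rewrite -dk; apply: dlt_sub dz => r [rM'|->] v; rewrite /D fZ; last by exists (f v).
  by rewrite rM'; exists 0; rewrite scaler0.
(* [E1] comes from M'/M, in degree d-2, and [E2] from M/D, in degree d-1; both are padded to degree
   d. *)
exists E1, E2; rewrite {1 2}dk; split; first exact: polylike_lift (polylike_lift p1).
split; first exact: polylike_lift p2.
split=> // n; have hID := sadd_submod (hI n) hD.
rewrite {1}/ell (qlen_add hID (sub_saddl hD) (fun v _ => I) (ffinM n)) PoszD.
apply: lerD; last exact: h2.
have hp : is_submod (fun u => Ipow M y n (phi u)) := preim_submod phi_lin (hI n).
(* [phi] identifies M'/phi^-1(I^nM) with (I^nM + D)/I^nM, and I^nM' lies in phi^-1(I^nM), so this
   length is at most l(M'/I^nM'). *)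
have <- : ell (fun u => Ipow M y n (phi u)) = qlen (Ipow M y n) (sadd (Ipow M y n) D).
  apply: (iso_qlen phi_lin) => //.
  - exact: sub_saddl.
  - by move=> u _; apply: sub_saddr => //; exists u.
  - move=> _ [a [b [ha [/Dphi [u ->] ->]]]]; exists u; split=> //; by rewrite addrK.
have sI : sub (Ipow M' y n) (fun u => Ipow M y n (phi u)).
  apply: IM_min => // a u ay; have [_ phiZ] := phi_lin.
  by rewrite phiZ; apply: IM_gen.
by rewrite lez_nat {2}/ell (qlen_add hp sI (fun v _ => I) (ffin n)) leq_addl.
Qed.

End Equality.
End Macaulayfication.

Lemma xpow_powS (R : comNzRingType) (x : seq R) (n : seq nat) : size n = size x ->
  all (fun k => 0 < k)%N n -> xpow x n = powS x [seq k.-1 | k <- n].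
Proof.
move=> sn pn; have sz : size (zip x [seq k.-1 | k <- n]) = size x.
  by rewrite size_zip size_map sn minnn.
apply: (@eq_from_nth _ 0); first by rewrite !size_map size_iota sz.
move=> i; rewrite size_map size_iota => lt.
rewrite (nth_map 0%N) ?size_iota // nth_iota // (nth_map (0, 0%N)) ?sz //.
rewrite nth_zip ?size_map //= (nth_map 0%N) ?sn // add0n prednK //.
by apply: (allP pn); apply: mem_nth; rewrite sn.
Qed.

Theorem theorem4p3 (R : comNzRingType) (m : R -> Prop)
    (M M' N : lmodType R) (f : {linear M -> M'}) (g : {linear M' -> N})
    (d : nat) (x : seq R) :
  noetherian_ring R -> local_ring_with m ->
  fin_gen M -> dim_eq M d ->
  injective f -> (forall z : N, exists w, g w = z) ->
  (forall w, g w = 0 <-> exists v, w = f v) ->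
  fin_gen M' -> cohen_macaulay M' m ->
  dim_le N (d%:Z - 2) ->
  size x = d -> sop M m x ->
  forall n : seq nat, size n = d -> all (fun k => 0 < k)%N n ->
    Jfun M x n = (ell (IM N (xpow x n)))%:Z.
Proof.
move=> nR lm fgM dM finj gsur ex fgM' cm dN sx [xm [_ xfin]] n sn pn.
(* For d < 2 the integer bound is negative, so there is no chain at all, in agreement with the
   truncated [d.-1] = 0. *)
have dN' : dlt (ann N) d.-1 by move=> c l /dN; lia.
have dM' : dim_eq M' d.
  by apply: (dim_middle finj ex dM); apply: dlt_leq dN'; apply: leq_pred.
have [w [sw regw]] := cm d dM'.
have wm a : a \in w -> m a.
  by move=> aw; have [h _] := regw; rewrite -(nth_index 0 aw); apply: h; rewrite index_mem.
have regw' := regular_regB regw.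
have dM'' : dlt (ann M') d.+1 by move=> c l /(proj1 dM'); rewrite lez_nat ltnS.
rewrite -sx in sn; have ey := xpow_powS sn pn; set y := xpow x n in ey *.
have xM : mprimary m M x by apply: (mprimary_of_finlen nR lm fgM xfin).
have yM : mprimary m M y.
  by rewrite ey; apply: (mprimary_powS (s := [::])) => //; rewrite size_map.
have sy : size y = d by rewrite size_map size_iota.
have ym a : a \in y -> m a.
  rewrite ey => /mapP [[b k] /= bk ->]; rewrite exprS; apply: (idlMr _ (m_ideal lm)).
  have bx : b \in x.
    by rewrite -(@unzip1_zip _ _ x [seq k.-1 | k <- n]) ?size_map ?sn //; apply: (map_f fst bk).
  by rewrite -(nth_index 0 bx); apply: xm; rewrite index_mem.
have [c hc] := hilbert_samuel nR lm (fg_noeth nR fgM) yM.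
rewrite /Jfun -/y (emult_polylike hc) (limcl_eq nR lm fgM' finj ex wm regw' sw dN' dM'' sy ym yM).
rewrite sy in hc.
rewrite (multiplicity_eq nR lm fgM fgM' finj ex wm regw' sw dN' dM'' sy yM hc).
have hy := IM_submod M' y.
have yfin : finlen (IM M' y) (@full M').
  have yM' := mprimary_M' nR lm fgM' ex wm regw' sw dN' yM.
  by rewrite -Ipow1; apply: (finlen_Ipow0 nR lm (fg_noeth nR fgM') yM').
by rewrite (ell_split f hy yfin) (ell_push gsur ex) PoszD addrC addKr.
Qed.
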